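(* Let $s\ge 2$ be an integer and $b=\sqrt{s}$. There exist positive constants $c_1$, $c_2$ and $\beta_0$ (depending on $s$) such that for every $\beta\le\beta_0$, $$\exp\left(-\frac{c_1}{\beta^2}\right)\le h_c(\beta)\le \exp\left(-\frac{c_2}{\beta}\right).$$
   Context: Hierarchical pinning model with site disorder. Fix an integer $s\ge 2$ and a real $b>1$. Let $\omega_1$ be a real random variable (law $\mathbb P$, expectation $\mathbb E$) with $\mathbb E[\omega_1]=0$, $\mathbb E[\omega_1^2]=1$ and $M(\beta):=\mathbb E[e^{\beta\omega_1}]<\infty$ for every $\beta>0$. For $\beta>0$, $h\in\mathbb R$, let $A$ denote a random variable with the law of $\exp(\beta\omega_1-\log M(\beta)+h)$. Define random variables $R_n=R_n(\beta,h)$ (in law) recursively by $R_0:=1$ and $$R_{n+1}=\frac{\prod_{j=1}^{s}R_n^{(j)}\prod_{j=1}^{s-1}A_j+b-1}{b},$$ where $R_n^{(1)},\dots,R_n^{(s)},A_1,\dots,A_{s-1}$ are independent, each $R_n^{(j)}$ has the law of $R_n$ and each $A_j$ has the law of $A$. The free energy is $\textsc{f}(\beta,h):=\lim_{n\to\infty}s^{-n}\mathbb E\log R_n$ (this limit exists, is also the almost sure limit of $s^{-n}\log R_n$, and is non-negative and non-decreasing in $h$). The critical point is $h_c(\beta):=\inf\{h:\textsc{f}(\beta,h)>0\}$. *)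

(* Defs.v *)
From HB Require Import structures.
From mathcomp Require Import all_boot all_order all_algebra.
From mathcomp Require Import all_classical all_reals all_analysis.
Set Implicit Arguments. Unset Strict Implicit. Unset Printing Implicit Defensive.
Import Order.TTheory GRing.Theory Num.Theory.
Import numFieldNormedType.Exports.
Local Open Scope classical_set_scope.
Local Open Scope ring_scope.

Definition mutually_independent d (T : measurableType d) (R : realType)
  (P : probability T R) (X : nat -> {RV P >-> R}) : Prop :=
  forall (I : seq nat) (B : nat -> set R), uniq I ->
    (forall i, measurable (B i)) ->
    P (\big[setI/setT]_(i <- I) (X i @^-1` B i)) =
    (\prod_(i <- I) P (X i @^-1` B i))%E.

Definition identically_distributed d (T : measurableType d) (R : realType)
  (P : probability T R) (X : nat -> {RV P >-> R}) : Prop :=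
  forall i (B : set R), measurable B -> P (X i @^-1` B) = P (X 0%N @^-1` B).

(* Hierarchical recursion, realized pathwise: R_n is a deterministic function
   of the s^n - 1 variables a 0, ..., a (s^n - 2) (the A's).  The j-th copy
   R_n^(j) (j < s) uses the block of indices j*(s^n-1) + [0, s^n - 1), and the
   s-1 extra A's use indices s*(s^n-1) + j, j < s-1. *)
Fixpoint Rhier (R : realType) (s : nat) (b : R) (n : nat) (a : nat -> R) : R :=
  match n with
  | 0 => 1
  | n'.+1 =>
      ((\prod_(j < s) Rhier s b n' (fun i => a (j * (s ^ n' - 1) + i)%N))
        * (\prod_(j < s.-1) a (s * (s ^ n' - 1) + j)%N) + b - 1) / b
  end.

Definition Mgf d (T : measurableType d) (R : realType) (P : probability T R)
  (om : nat -> {RV P >-> R}) (beta : R) : R :=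
  fine (\int[P]_x (expR (beta * om 0%N x))%:E).

Definition Avar d (T : measurableType d) (R : realType) (P : probability T R)
  (om : nat -> {RV P >-> R}) (beta h : R) (i : nat) (x : T) : R :=
  expR (beta * om i x - ln (Mgf om beta) + h).

Definition ElogR d (T : measurableType d) (R : realType) (P : probability T R)
  (om : nat -> {RV P >-> R}) (s : nat) (b beta h : R) (n : nat) : R :=
  fine (\int[P]_x (ln (Rhier s b n (fun i => Avar om beta h i x)))%:E).

Definition free_energy d (T : measurableType d) (R : realType)
  (P : probability T R) (om : nat -> {RV P >-> R}) (s : nat) (b beta h : R) : R :=
  limn (fun n => ElogR om s b beta h n / (s ^ n)%:R).

Definition hcrit d (T : measurableType d) (R : realType)
  (P : probability T R) (om : nat -> {RV P >-> R}) (s : nat) (b beta : R) : R :=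
  inf [set h : R | 0 < free_energy om s b beta h].

(* Main.v *)
Require Import Defs.
From HB Require Import structures.
From mathcomp Require Import all_boot all_order all_algebra.
From mathcomp Require Import ring lra.
From mathcomp Require Import all_classical all_reals all_analysis.
From mathcomp Require Import measurable_realfun.
Import Order.TTheory GRing.Theory Num.Theory.
Import numFieldNormedType.Exports.
Set Implicit Arguments. Unset Strict Implicit. Unset Printing Implicit Defensive.
Local Open Scope classical_set_scope.
Local Open Scope ring_scope.

(** With [b ^ 2 = s] the expected number of common contacts of two replicas in
    a system of level [n] is of order [n], which makes disorder marginal.

    Upper bound on the critical point.  At [h = exp (- c2 / beta)] let [n] be
    the first level where the annealed partition function exceeds a large
    constant, so that [n] is at most a small multiple of [1 / beta].  The
    relative variance [w] of [R_n] satisfies [w' <= rho ^ 2 * (w + C * beta ^ 2)]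
    as long as [w <= beta], with a bounded product of the [rho]'s, hence it is
    still small at level [n].  Then [E log R_n] is large, and superadditivity of
    [E log R_n] makes the free energy positive.

    Lower bound.  Let [n] be of order [1 / beta ^ 2] and tilt the law of each
    site by the density [1 - delta * psi], [psi] the centered indicator of
    [omega > 0].  Sites introduced at level [m] get a [delta] proportional to
    their Green function [b ^ (m - n)]; this inhomogeneous choice has bounded
    relative entropy but pushes the tilted mean of [R_n] to [1 - alpha / 2].
    Young's inequality [x ^ p <= p * (x * g) + (1 - p) * g ^ (- k)], with
    [p = k / (k + 1)] and [g] the density of the tilted law, transfers this to
    [E (R_n ^ p) <= 1 - alpha / 4].  For [p] close to [1] and [h] tiny the
    recursion keeps that bound at all later levels, so [E log R_m <= 0]. *)

(** * Independence of the blocks of the environment *)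

Section sequence_space.
Variable R : realType.

Definition cylinder (n : nat) (B : nat -> set R) : set (nat -> R) :=
  [set a | forall i, (i < n)%N -> B i (a i)].

Definition cylinders : set (set (nat -> R)) :=
  [set A | exists n B, (forall i, measurable (B i)) /\ A = cylinder n B].

Definition seqT := [the measurableType _ of g_sigma_algebraType cylinders].

Definition shift (k : nat) (a : seqT) : seqT := fun i => a (k + i)%N.

(** Gluing map. That the product of the environment law with itself is sent back to that law
    expresses at once independence of the first [N] sites from the rest and stationarity. *)
Definition splice (N : nat) (a : seqT * seqT) : seqT :=
  fun i => if (i < N)%N then a.1 i else a.2 (i - N)%N.

Definition depends_below (N : nat) (A : Type) (f : seqT -> A) :=
  forall a a', (forall i, (i < N)%N -> a i = a' i) -> f a = f a'.

Lemma setI_closed_cylinders : setI_closed cylinders.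
Proof.
move=> _ _ [n [B [mB ->]]] [n' [B' [mB' ->]]].
exists (maxn n n'), (fun i => (if (i < n)%N then B i else setT) `&`
  (if (i < n')%N then B' i else setT)); split.
  by move=> i; apply: measurableI; case: ifP.
apply/seteqP; split=> a /=.
  by move=> [h h'] i _; split; case: ifP => // ?; [apply: h|apply: h'].
move=> h; split=> i ilt.
  by have := h i; rewrite leq_max ilt => /(_ isT)[].
by have := h i; rewrite leq_max ilt orbT => /(_ isT)[].
Qed.

Lemma measurable_coord i : measurable_fun setT (fun a : seqT => a i).
Proof.
move=> _ B mB; rewrite setTI; apply: sub_sigma_algebra.
exists i.+1, (fun j => if j == i then B else setT); split.
  by move=> j; case: ifP.
apply/seteqP; split=> a /=.
  by move=> h j _; case: eqP => // ->.
by move=> /(_ i (ltnSn i)); rewrite eqxx.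
Qed.

Lemma measurable_to_seqT d (T : measurableType d) (f : T -> seqT) :
  (forall i, measurable_fun setT (fun x => f x i)) -> measurable_fun setT f.
Proof.
move=> mf; apply: (@measurability _ _ _ seqT setT f cylinders) => //.
move=> _ [_ [n [B [mB ->]]] <-]; rewrite setTI.
rewrite [X in measurable X](_ : _ =
    \bigcap_i (if (i < n)%N then (fun x => f x i) @^-1` (B i) else setT)).
  apply: bigcapT_measurable => i; case: ifP => // _.
  by rewrite -[X in measurable X]setTI; exact: mf.
apply/seteqP; split=> x /=.
  by move=> h i _; case: ifP => // ?; exact: h.
by move=> h i ilt; have := h i I; rewrite ilt.
Qed.

Lemma measurable_shift k : measurable_fun setT (shift k).
Proof. by apply: measurable_to_seqT => i; exact: measurable_coord. Qed.

Lemma measurable_splice N : measurable_fun setT (splice N).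
Proof.
apply: measurable_to_seqT => i; rewrite /splice /=; case: (ltnP i N) => _.
  exact: (measurableT_comp (measurable_coord i) measurable_fst).
exact: (measurableT_comp (measurable_coord (i - N)) measurable_snd).
Qed.

Lemma cylinder_unique (m1 m2 : {measure set seqT -> \bar R}) :
  (forall n B, (forall i, measurable (B i)) ->
    m1 (cylinder n B) = m2 (cylinder n B)) ->
  (m1 setT < +oo)%E -> forall A, measurable A -> m1 A = m2 A.
Proof.
move=> h fin A mA.
have cylT : cylinders setT.
  exists 0%N, (fun=> setT); split=> //.
  by apply/seteqP; split=> // a _ i.
apply: (@measure_unique _ R seqT cylinders (fun=> setT)) => //.
- exact: setI_closed_cylinders.
- by rewrite bigcup_const.
- by move=> _ [n [B [mB ->]]]; exact: h.
Qed.

(** The product inside one recursion step, for an arbitrary block functional and site function, so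
    that moments of [Rn], fractional powers and tilting densities all factorize by one lemma. *)
Definition hier (s N : nat) (f : seqT -> R) (w : R -> R) (a : seqT) : R :=
  (\prod_(j < s) f (shift (j * N) a)) * \prod_(j < s.-1) w (a (s * N + j)%N).

Lemma hier_ge0 s N f w a : (forall a, 0 <= f a) -> (forall t, 0 <= w t) ->
  0 <= hier s N f w a.
Proof. by move=> f0 w0; rewrite mulr_ge0// prodr_ge0. Qed.

Lemma measurable_hier s N f w : measurable_fun setT f -> measurable_fun setT w ->
  measurable_fun setT (hier s N f w).
Proof.
move=> mf mw; apply: measurable_funM; apply: measurable_prod => j _.
  exact: measurableT_comp mf (measurable_shift _).
exact: measurableT_comp mw (measurable_coord _).
Qed.

End sequence_space.

(** * Factorization of expectations over disjoint blocks *)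

Section independence.
Variables (R : realType) (nu : probability (seqT R) R) (mu : set R -> \bar R).
Hypothesis nu_cylinder : forall n (B : nat -> set R),
  (forall i, measurable (B i)) -> nu (cylinder n B) = (\prod_(i < n) mu (B i))%E.

Local Notation E f := (\int[nu]_a (f a)%:E)%E.

(** The preimage of a cylinder under [splice N] is a rectangle of two cylinders, cut at coordinate
    [N]; the two product formulas multiply back to the one for the original cylinder, and cylinders
    determine the law. *)
Lemma splice_law N (A : set (seqT R)) : measurable A ->
  (nu \x nu)%E (splice N @^-1` A) = nu A.
Proof.
move=> mA; have ms := measurable_splice (R := R) N.
pose f : {mfun (seqT R * seqT R)%type >-> seqT R} := HB.pack (splice (R := R) N)
  (isMeasurableFun.Build _ _ _ _ _ ms).
have -> : (nu \x nu)%E (splice N @^-1` A) = pushforward (nu \x nu)%E f A by [].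
have key n (B : nat -> set R) : (forall i, measurable (B i)) ->
   pushforward (nu \x nu)%E f (cylinder n B) = nu (cylinder n B).
  move=> mB; rewrite /pushforward /=.
  have -> : splice N @^-1` cylinder n B =
     cylinder (minn n N) B `*` cylinder (n - N) (fun i => B (N + i)%N).
    apply/seteqP; split=> -[a a'] /=; rewrite /splice /cylinder /=.
      move=> h; split=> i.
        by rewrite leq_min => /andP[/h + iN]; rewrite iN.
      rewrite ltn_subRL => /h; rewrite ltnNge leq_addr /=.
      by rewrite addKn.
    move=> [h h'] i ilt; case: ifPn => iN; first by apply: h; rewrite leq_min ilt.
    have Ni : (N <= i)%N by rewrite leqNgt.
    by have := h' (i - N)%N; rewrite ltn_sub2rE// subnKC//; apply.
  have mcyl k (C : nat -> set R) : (forall i, measurable (C i)) ->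
    measurable (cylinder k C : set (seqT R)).
    by move=> mC; apply: sub_sigma_algebra; exists k, C.
  rewrite product_measure1E; try exact: mcyl.
  rewrite [in RHS]nu_cylinder//.
  rewrite /= (nu_cylinder (minn n N) mB) (nu_cylinder (n - N) (fun i => mB (N + i)%N)).
  rewrite -(big_mkord xpredT (fun i => mu (B (N + i)%N))).
  rewrite -!(big_mkord xpredT (fun i => mu (B i))).
  have [nN|Nn] := leqP n N.
    by rewrite (eqP (nN : (n - N)%N == 0%N)) [X in (_ * X)%E]big_nil mule1.
  rewrite [RHS](big_cat_nat _ (n := N))//=; last exact: ltnW.
  congr (_ * _)%E; rewrite -[X in (\prod_(X <= _ < n) _)%E]add0n big_addn.
  by apply: eq_bigr => i _; rewrite addnC.
apply: (cylinder_unique (m1 := pushforward (nu \x nu)%E f)) => //.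
rewrite /= /pushforward preimage_setT -setXTT product_measure1E//.
by rewrite /= (probability_setT nu) mule1 ltry.
Qed.

Lemma splice_integral N (F : seqT R -> \bar R) : measurable_fun setT F ->
  (forall a, (0 <= F a)%E) ->
  (\int[nu]_a F a = \int[nu]_a \int[nu]_a' F (splice N (a, a')))%E.
Proof.
move=> mF F0; have ms := measurable_splice (R := R) N.
transitivity (\int[pushforward (nu \x nu)%E (splice (R := R) N)]_a F a)%E.
  by apply: eq_measure_integral => A mA _; rewrite /= -(splice_law N mA).
rewrite ge0_integral_pushforward// fubini_tonelli1//.
  exact: measurableT_comp mF ms.
by move=> x; exact: F0.
Qed.

(** After splicing, [f] sees only the first environment and the shifted [g] only the second, so
    Tonelli separates them. *)
Lemma integral_indep N (f g : seqT R -> R) :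
  measurable_fun setT f -> measurable_fun setT g ->
  (forall a, 0 <= f a) -> (forall a, 0 <= g a) -> depends_below N f ->
  E (fun a => f a * g (shift N a)) = (E f * E g)%E.
Proof.
move=> mf mg f0 g0 df.
have mfE : measurable_fun setT (EFin \o f) by exact/measurable_EFinP.
have mgE : measurable_fun setT (EFin \o g) by exact/measurable_EFinP.
rewrite (splice_integral N)/=; last 2 first.
- apply/measurable_EFinP; apply: measurable_funM => //.
  exact: measurableT_comp mg (measurable_shift _).
- by move=> a; rewrite lee_fin mulr_ge0.
transitivity (\int[nu]_a ((f a)%:E * E g))%E.
  apply: eq_integral => a _.
  rewrite -ge0_integralZl//; last by rewrite lee_fin.
    apply: eq_integral => a' _; rewrite -EFinM; congr (_ * _)%:E.
      by apply: df => i iN; rewrite /splice iN.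
    congr g; apply/funext => i; rewrite /shift /splice /=.
    by rewrite ltnNge leq_addr /= addKn.
  by move=> x _; rewrite lee_fin.
rewrite ge0_integralZr//; first by move=> x _; rewrite lee_fin.
by apply: integral_ge0 => x _; rewrite lee_fin.
Qed.

Lemma integral_shift k (g : seqT R -> R) :
  measurable_fun setT g -> (forall a, 0 <= g a) ->
  E (fun a => g (shift k a)) = E g.
Proof.
move=> mg g0; have := @integral_indep k (fun=> 1) g.
under eq_integral do rewrite mul1r.
by move=> ->//; rewrite (integral_cst nu measurableT 1) /= (probability_setT nu) !mul1e.
Qed.

Lemma integral_prod_blocks N k (f g : seqT R -> R) (x y : R) :
  measurable_fun setT f -> measurable_fun setT g ->
  (forall a, 0 <= f a) -> (forall a, 0 <= g a) -> depends_below N f ->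
  E f = x%:E -> E g = y%:E ->
  E (fun a => (\prod_(j < k) f (shift (j * N) a)) * g (shift (k * N) a))
    = (x ^+ k * y)%:E.
Proof.
move=> mf mg f0 g0 df Ef Eg; elim: k => [|k IH].
  under eq_integral do rewrite big_ord0 mul1r mul0n.
  by rewrite expr0 mul1r -Eg; apply: eq_integral => a _.
pose G a := (\prod_(j < k) f (shift (j * N) a)) * g (shift (k * N) a).
have mG : measurable_fun setT G.
  apply: measurable_funM.
    by apply: measurable_prod => j _; exact: measurableT_comp mf (measurable_shift _).
  exact: measurableT_comp mg (measurable_shift _).
transitivity (E (fun a => f a * G (shift N a))).
  apply: eq_integral => a _; congr (_%:E).
  rewrite big_ord_recl mul0n -mulrA; congr (_ * _); rewrite /G.
  congr (_ * _); last by congr g; apply/funext => i; rewrite /shift mulSn addnA.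
  by apply: eq_bigr => j _; congr f; apply/funext => i; rewrite /shift /bump mulSn addnA.
rewrite integral_indep// ?Ef ?IH -?EFinM ?exprS ?mulrA//.
by move=> a; rewrite mulr_ge0// prodr_ge0.
Qed.

(** The block lemma is used twice: for the [s] blocks of length [N], and for the [s.-1] extra sites
    seen as blocks of length 1. *)
Lemma integral_hier N (s : nat) (f : seqT R -> R) (w : R -> R) (x y : R) :
  measurable_fun setT f -> measurable_fun setT w ->
  (forall a, 0 <= f a) -> (forall t, 0 <= w t) -> depends_below N f ->
  E f = x%:E -> E (fun a => w (a 0%N)) = y%:E ->
  E (hier s N f w) = (x ^+ s * y ^+ s.-1)%:E.
Proof.
move=> mf mw f0 w0 df Ef Ew.
have mw0 i : measurable_fun setT (fun a : seqT R => w (a i)).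
  exact: measurableT_comp mw (measurable_coord i).
apply: (@integral_prod_blocks N s f (fun a => \prod_(j < s.-1) w (a j))) => //.
- by apply: measurable_prod => j _; exact: mw0.
- by move=> a; exact: prodr_ge0.
have := @integral_prod_blocks 1 s.-1 (fun a => w (a 0%N)) (fun=> 1) y 1.
rewrite mulr1 => <-//.
- apply: eq_integral => a _; congr (_%:E); rewrite mulr1.
  by apply: eq_bigr => j _; rewrite /shift muln1 addn0.
- by move=> a a' h; rewrite h.
- by rewrite (integral_cst nu measurableT 1) /= (probability_setT nu) mule1.
Qed.

End independence.

(** * Law of the disorder sequence *)

Section law_of_environment.
Context d (T : measurableType d) (R : realType) (P : probability T R).
Variable om : nat -> {RV P >-> R}.
Hypotheses (Hind : mutually_independent om) (Hid : identically_distributed om).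

Definition env (x : T) : seqT R := fun i => om i x.

Lemma measurable_env : measurable_fun setT env.
Proof. by apply: measurable_to_seqT => i; exact: measurable_funPT. Qed.

HB.instance Definition _ := isMeasurableFun.Build _ _ _ _ env measurable_env.

Definition envlaw : probability (seqT R) R := distribution P env.

Lemma envlaw_cylinder n (B : nat -> set R) : (forall i, measurable (B i)) ->
  envlaw (cylinder n B) = (\prod_(i < n) P (om 0%N @^-1` (B i)))%E.
Proof.
move=> mB; rewrite /envlaw /distribution/= /pushforward/=.
transitivity (P (\big[setI/setT]_(i <- iota 0 n) (om i @^-1` B i))).
  congr (P _); rewrite -bigcap_seq; apply/seteqP; split=> x /= h i.
    by rewrite /= mem_iota => /h.
  by move=> ilt; apply: h; rewrite /= mem_iota.
rewrite Hind ?iota_uniq// -(big_mkord xpredT (fun i => P (om 0%N @^-1` B i))).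
rewrite /index_iota subn0; apply: eq_bigr => i _; exact: Hid.
Qed.

Lemma ge0_integral_envlaw (F : seqT R -> \bar R) : measurable_fun setT F ->
  (forall a, (0 <= F a)%E) -> (\int[envlaw]_a F a = \int[P]_x F (env x))%E.
Proof.
by move=> mF F0; rewrite ge0_integral_pushforward//; exact: measurable_env.
Qed.

End law_of_environment.

(** * Expectations of hierarchical functionals *)

Section ge0_expectation.
Context d (T : measurableType d) (R : realType) (P : probability T R).
Local Notation E f := (\int[P]_a (f a)%:E)%E.
Implicit Types f g : T -> R.

Lemma expect_cst (c : R) : E (fun=> c) = c%:E.
Proof. by rewrite (integral_cst P measurableT) /= (probability_setT P) mule1. Qed.

Lemma expect_comb f g (c k x y : R) :
  measurable_fun setT f -> measurable_fun setT g ->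
  (forall a, 0 <= f a) -> (forall a, 0 <= g a) -> 0 <= c -> 0 <= k ->
  E f = x%:E -> E g = y%:E ->
  E (fun a => c * f a + k * g a) = (c * x + k * y)%:E.
Proof.
move=> mf mg f0 g0 c0 k0 Ef Eg.
under eq_integral do rewrite EFinD 2!EFinM.
rewrite ge0_integralD//; last 4 first.
- by move=> a _; rewrite -EFinM lee_fin mulr_ge0.
- apply: measurable_funeM; exact/measurable_EFinP.
- by move=> a _; rewrite -EFinM lee_fin mulr_ge0.
- apply: measurable_funeM; exact/measurable_EFinP.
rewrite !ge0_integralZl//; try exact/measurable_EFinP; try by move=> a _; rewrite lee_fin.
by rewrite Ef Eg.
Qed.

Lemma expect_affine f (c k x : R) :
  measurable_fun setT f -> (forall a, 0 <= f a) -> 0 <= c -> 0 <= k ->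
  E f = x%:E -> E (fun a => c * f a + k) = (c * x + k)%:E.
Proof.
move=> mf f0 c0 k0 Ef.
rewrite -[in RHS](mulr1 k) -(@expect_comb f (fun=> 1) c k x 1)//.
  by under [RHS]eq_integral do rewrite mulr1.
exact: expect_cst.
Qed.

Lemma expect_le f g : measurable_fun setT f -> measurable_fun setT g ->
  (forall a, 0 <= f a) -> (forall a, f a <= g a) -> (E f <= E g)%E.
Proof.
move=> mf mg f0 fg; apply: ge0_le_integral => //.
- by move=> a _; rewrite lee_fin.
- exact/measurable_EFinP.
- exact/measurable_EFinP.
- by move=> a _; rewrite lee_fin.
Qed.

Lemma expect_le_fine f (x : R) : (forall a, 0 <= f a) -> (E f <= x%:E)%E ->
  exists2 y : R, E f = y%:E & 0 <= y <= x.
Proof.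
move=> f0 le; have ge : (0 <= E f)%E by apply: integral_ge0 => a _; rewrite lee_fin.
have fin : E f \is a fin_num by rewrite ge0_fin_numE// (le_lt_trans le)// ltry.
by exists (fine (E f)); rewrite ?fineK// -!lee_fin fineK// ge le.
Qed.

End ge0_expectation.

Section hierarchical_functionals.
Variables (R : realType) (s : nat) (b : R) (A : R -> R).
Hypotheses (s_gt0 : (0 < s)%N) (b_gt1 : 1 < b).
Hypotheses (mA : measurable_fun setT A) (A_ge0 : forall t, 0 <= A t).

Definition Rn n (a : seqT R) : R := Rhier s b n (fun i => A (a i)).

(** Unfolded, the product over all sites of the level [n] system of [w m], where [m] is the level
    whose copies the site joins. With weights of mean 1 it is the density of an inhomogeneous
    product tilt. *)
Fixpoint hier_weight (w : nat -> R -> R) n (a : seqT R) : R :=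
  if n is n'.+1 then hier s (s ^ n' - 1) (hier_weight w n') (w n') a else 1.

Lemma RnS n a : Rn n.+1 a = (hier s (s ^ n - 1) (Rn n) A a + b - 1) / b.
Proof. by []. Qed.

(** The pinning product is nonnegative. This deterministic floor controls [ln (Rn n)] from below and
    later bounds the inverse of [Rn] in the second moment estimate. *)
Lemma Rn_lb n a : (b - 1) / b <= Rn n a.
Proof.
have b0 : 0 < b by exact: lt_trans b_gt1.
elim: n a => [|n IH] a; first by rewrite /Rn/= ler_pdivrMr// mul1r lerBlDr lerDl.
rewrite RnS ler_pM2r ?invr_gt0// -addrA lerDr; apply: hier_ge0 => // {}a.
by rewrite (le_trans _ (IH _))// divr_ge0 ?ltW// subr_gt0.
Qed.

Lemma Rn_gt0 n a : 0 < Rn n a.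
Proof.
by rewrite (lt_le_trans _ (Rn_lb n a))// divr_gt0 ?subr_gt0// (lt_trans _ b_gt1).
Qed.

Lemma block_lt n (j : 'I_s) i : (i < s ^ n - 1)%N ->
  (j * (s ^ n - 1) + i < s ^ n.+1 - 1)%N.
Proof.
move=> ilt; have sn : (0 < s ^ n)%N by rewrite expn_gt0 s_gt0.
apply: (@leq_trans (j.+1 * (s ^ n - 1))); first by rewrite mulSn addnC ltn_add2r.
apply: (@leq_trans (s * (s ^ n - 1))); first by rewrite leq_mul2r ltn_ord orbT.
by rewrite mulnBr muln1 expnS leq_sub2l.
Qed.

(** Index count: [s * (s ^ n - 1) + (s - 1) = s ^ n.+1 - 1], so blocks and extra sites exactly fill
    the next level. *)
Lemma extra_lt n (j : 'I_s.-1) : (s * (s ^ n - 1) + j < s ^ n.+1 - 1)%N.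
Proof.
have sn : (0 < s ^ n)%N by rewrite expn_gt0 s_gt0.
apply: (@leq_trans (s * (s ^ n - 1) + s.-1)); first by rewrite ltn_add2l.
rewrite mulnBr muln1 expnS -subn1 addnBA// subnK// leq_pmulr//.
Qed.

Lemma Rn_depends n : depends_below (s ^ n - 1) (Rn n).
Proof.
elim: n => [|n IH] a a' h; first by [].
rewrite !RnS /hier; congr ((_ * _ + _ - _) / _).
  by apply: eq_bigr => j _; apply: IH => i ilt; apply: h; exact: block_lt.
by apply: eq_bigr => j _; rewrite h//; exact: extra_lt.
Qed.

Lemma hier_weight_depends w n : depends_below (s ^ n - 1) (hier_weight w n).
Proof.
elim: n => [|n IH] a a' h; first by [].
rewrite /= /hier; congr (_ * _).
  by apply: eq_bigr => j _; apply: IH => i ilt; apply: h; exact: block_lt.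
by apply: eq_bigr => j _; rewrite h//; exact: extra_lt.
Qed.

Lemma measurable_Rn n : measurable_fun setT (Rn n).
Proof.
elim: n => [|n IH]; first exact: measurable_cst.
rewrite (_ : Rn n.+1 = (fun a => (hier s (s ^ n - 1) (Rn n) A a + (b - 1)) / b)).
  apply: measurable_funM; last exact: measurable_cst.
  by apply: measurable_funD; [exact: measurable_hier|exact: measurable_cst].
by apply/funext => a; rewrite RnS addrA.
Qed.

Lemma measurable_hier_weight w n : (forall m, measurable_fun setT (w m)) ->
  measurable_fun setT (hier_weight w n).
Proof.
move=> mw; elim: n => [|n IH]; first exact: measurable_cst.
exact: (measurable_hier _ _ IH (mw n)).
Qed.

Lemma hier_weight_ge0 w n a : (forall m t, 0 <= w m t) -> 0 <= hier_weight w n a.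
Proof.
by move=> w0; elim: n a => [|n IH] a //=; exact: hier_ge0.
Qed.

Lemma hier_weight_gt0 w n a : (forall m t, 0 < w m t) -> 0 < hier_weight w n a.
Proof.
by move=> w0; elim: n a => [|n IH] a //=; rewrite /hier mulr_gt0// prodr_gt0.
Qed.

Lemma hier_weight_exp w k n a : hier_weight w n a ^+ k = hier_weight (fun m t => w m t ^+ k) n a.
Proof.
elim: n a => [|n IH] a /=; first by rewrite expr1n.
by rewrite /hier exprMn -!prodrXl; congr (_ * _); apply: eq_bigr => j _.
Qed.

Lemma hier_weight_inv w n a : (hier_weight w n a)^-1 = hier_weight (fun m t => (w m t)^-1) n a.
Proof.
elim: n a => [|n IH] a /=; first by rewrite invr1.
by rewrite /hier invfM -!prodfV; congr (_ * _); apply: eq_bigr => j _.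
Qed.

Section expectations.
Variables (nu : probability (seqT R) R) (mu : set R -> \bar R).
Hypothesis nu_cylinder : forall n (B : nat -> set R),
  (forall i, measurable (B i)) -> nu (cylinder n B) = (\prod_(i < n) mu (B i))%E.
Local Notation E f := (\int[nu]_a (f a)%:E)%E.
Local Notation E1 w := (\int[nu]_a (w (a 0%N : R))%:E)%E.

(** The exponent counts the sites introduced at level [m]: [s.-1] of them when they appear, then
    multiplied by [s] at each later level. *)
Lemma expect_hier_weight (w : nat -> R -> R) (y : nat -> R) n : (forall m, measurable_fun setT (w m)) ->
  (forall m t, 0 <= w m t) -> (forall m, (m < n)%N -> E1 (w m) = (y m)%:E) ->
  E (hier_weight w n) = (\prod_(m < n) y m ^+ (s.-1 * s ^ (n.-1 - m)))%:E.
Proof.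
move=> mw w0; elim: n => [|n IH] Ew; first by rewrite big_ord0 expect_cst.
have IH' := IH (fun m mn => Ew m (ltnW mn)).
rewrite (integral_hier nu_cylinder _ (measurable_hier_weight n mw) (mw n) _ (w0 n)
  (@hier_weight_depends w n) IH' (Ew n (ltnSn n))); last by move=> a; exact: hier_weight_ge0.
rewrite big_ord_recr /= subnn expn0 muln1; congr ((_ * _)%:E).
rewrite -prodrXl; apply: eq_bigr => m _; rewrite -exprM -mulnA -expnSr.
by congr (_ ^+ (_ * _ ^ _)); rewrite -subSn ?prednK//; case: n m {IH IH' Ew} => [[]|n m] //; rewrite -ltnS.
Qed.

(** The density multiplies into the product block by block, while the additive constant [b - 1]
    meets a density of mean 1. Hence the tilted mean obeys the annealed recursion with the tilted
    site mean [y]. *)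
Lemma expect_Rn_hier_weight (w : nat -> R -> R) n (x y : R) : (forall m, measurable_fun setT (w m)) ->
  (forall m t, 0 <= w m t) -> (forall m, E1 (w m) = 1%:E) ->
  E (fun a => Rn n a * hier_weight w n a) = x%:E -> E1 (fun t => A t * w n t) = y%:E ->
  E (fun a => Rn n.+1 a * hier_weight w n.+1 a) = ((x ^+ s * y ^+ s.-1 + b - 1) / b)%:E.
Proof.
move=> mw w0 Ew Ex Ey; have b0 : 0 < b by exact: lt_trans b_gt1.
have EG : E (hier_weight w n.+1) = 1%:E.
  rewrite (@expect_hier_weight w (fun=> 1))//.
  by rewrite big1// => m _; rewrite expr1n.
have mRG : measurable_fun setT (fun a => Rn n a * hier_weight w n a).
  by apply: measurable_funM; [exact: measurable_Rn|exact: measurable_hier_weight].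
have mAw : measurable_fun setT (fun t => A t * w n t) by exact: measurable_funM.
have RG0 a : 0 <= Rn n a * hier_weight w n a by rewrite mulr_ge0 ?hier_weight_ge0// ltW// Rn_gt0.
have Aw0 t : 0 <= A t * w n t by rewrite mulr_ge0.
have dRG : depends_below (s ^ n - 1) (fun a => Rn n a * hier_weight w n a).
  by move=> a a' h; rewrite (Rn_depends h) (hier_weight_depends w h).
have := integral_hier nu_cylinder s mRG mAw RG0 Aw0 dRG Ex Ey.
set F := hier _ _ _ _ => EF.
have F0 a : 0 <= F a by exact: hier_ge0.
rewrite (_ : _ / b = b^-1 * (x ^+ s * y ^+ s.-1) + ((b - 1) / b) * 1); last first.
  by field; rewrite gt_eqF.
rewrite -(expect_comb (measurable_hier _ _ mRG mAw) (measurable_hier_weight n.+1 mw) F0 _ _ _ EF EG).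
- apply: eq_integral => a _; rewrite RnS /F /= /hier !big_split /=.
  by congr (_%:E); field; rewrite gt_eqF.
- by move=> a; exact: hier_weight_ge0.
- by rewrite invr_ge0 ltW.
- by rewrite divr_ge0 ?ltW// subr_gt0.
Qed.

Lemma expect_Rn n (x y : R) :
  E (Rn n) = x%:E -> E1 A = y%:E ->
  E (Rn n.+1) = ((x ^+ s * y ^+ s.-1 + b - 1) / b)%:E.
Proof.
move=> Ex Ey.
pose w (m : nat) (t : R) : R := 1.
have Gw m a : hier_weight w m a = 1.
  by elim: m a => // m IH a /=; rewrite /hier !big1 ?mulr1.
rewrite -(@expect_Rn_hier_weight w n x y)//.
- by apply: eq_integral => a _; rewrite Gw mulr1.
- by move=> m; exact: measurable_cst.
- by move=> m; exact: expect_cst.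
- by rewrite -Ex; apply: eq_integral => a _; rewrite Gw mulr1.
- by rewrite -Ey; apply: eq_integral => a _; rewrite mulr1.
Qed.

(** Expanding the square, the squared product is again a [hier], built from the squares, and the
    cross term is the mean of the product itself. *)
Lemma expect_Rn_sqr n (x y v q : R) :
  E (Rn n) = x%:E -> E1 A = y%:E ->
  E (fun a => Rn n a ^+ 2) = v%:E -> E1 (fun t => A t ^+ 2) = q%:E ->
  E (fun a => Rn n.+1 a ^+ 2) = ((v ^+ s * q ^+ s.-1 +
    2 * (b - 1) * (x ^+ s * y ^+ s.-1) + (b - 1) ^+ 2) / b ^+ 2)%:E.
Proof.
move=> Ex Ey Ev Eq; have b0 : 0 < b by exact: lt_trans b_gt1.
have R0 a : 0 <= Rn n a by rewrite ltW// Rn_gt0.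
have R20 a : 0 <= Rn n a ^+ 2 by rewrite sqr_ge0.
have A20 t : 0 <= A t ^+ 2 by rewrite sqr_ge0.
have mR2 : measurable_fun setT (fun a => Rn n a ^+ 2).
  by apply: measurable_funX; exact: measurable_Rn.
have mA2 : measurable_fun setT (fun t => A t ^+ 2) by exact: measurable_funX.
have dR2 : depends_below (s ^ n - 1) (fun a => Rn n a ^+ 2).
  by move=> a a' h; rewrite (Rn_depends h).
have := integral_hier nu_cylinder s mR2 mA2 R20 A20 dR2 Ev Eq.
set F := hier _ _ _ _ => EF.
have := integral_hier nu_cylinder s (measurable_Rn n) mA R0 A_ge0 (@Rn_depends n) Ex Ey.
set G := hier _ _ (Rn n) _ => EG.
have F0 a : 0 <= F a by exact: hier_ge0.
have G0 a : 0 <= G a by exact: hier_ge0.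
have mG : measurable_fun setT G by exact: (measurable_hier _ _ (measurable_Rn n) mA).
have b1 : 0 <= b - 1 by rewrite ltW// subr_gt0.
have c0 : 0 <= 2 * (b - 1) by rewrite mulr_ge0.
have EGk := expect_affine mG G0 c0 (sqr_ge0 (b - 1)) EG.
rewrite (_ : _ / b ^+ 2 = (b ^+ 2)^-1 * (v ^+ s * q ^+ s.-1) +
  (b ^+ 2)^-1 * (2 * (b - 1) * (x ^+ s * y ^+ s.-1) + (b - 1) ^+ 2)); last first.
  by field; rewrite gt_eqF.
have ib : 0 <= (b ^+ 2)^-1 by rewrite invr_ge0 sqr_ge0.
rewrite -(expect_comb (measurable_hier _ _ mR2 mA2) _ F0 _ ib ib EF EGk).
- apply: eq_integral => a _; rewrite RnS /F /G /hier !prodrXl; congr (_%:E).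
  by field; rewrite gt_eqF.
- apply: measurable_funD; last exact: measurable_cst.
  by apply: measurable_funM; first exact: measurable_cst.
- by move=> a; rewrite addr_ge0 ?sqr_ge0// mulr_ge0.
Qed.

End expectations.
End hierarchical_functionals.

(** * Expectations of signed integrable functions *)

Section expectation_value.
Context d (T : measurableType d) (R : realType) (P : probability T R).
Implicit Types (f g : T -> R) (x y c : R).

(** Integrability is bundled with the value because signed functions such as logarithms and [psi]
    must be added and compared. *)
Definition has_expect f x :=
  P.-integrable setT (EFin \o f) /\ (\int[P]_a (f a)%:E = x%:E)%E.

Lemma eq_has_expect f g x : (forall a, f a = g a) ->
  has_expect f x -> has_expect g x.
Proof. by move=> /funext ->. Qed.

Lemma has_expect_cst c : has_expect (fun=> c) c.
Proof.
by split; [exact: finite_measure_integrable_cst|exact: expect_cst].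
Qed.

Lemma has_expectD f g x y : has_expect f x -> has_expect g y ->
  has_expect (fun a => f a + g a) (x + y).
Proof.
move=> [fi fx] [gi gy]; split.
  apply: (eq_integrable measurableT (fun a => (f a)%:E + (g a)%:E)%E) => //.
  exact: integrableD.
by under eq_integral do rewrite EFinD; rewrite integralD// fx gy.
Qed.

Lemma has_expectZ c f x : has_expect f x -> has_expect (fun a => c * f a) (c * x).
Proof.
move=> [fi fx]; split.
  apply: (eq_integrable measurableT (fun a => c%:E * (EFin \o f) a)%E) => //.
  exact: integrableZl.
by under eq_integral do rewrite EFinM; rewrite integralZl// fx.
Qed.

Lemma has_expect_sum k (f : 'I_k -> T -> R) (x : 'I_k -> R) :
  (forall i, has_expect (f i) (x i)) ->
  has_expect (fun a => \sum_(i < k) f i a) (\sum_(i < k) x i).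
Proof.
elim: k f x => [|k IH] f x h.
  by rewrite big_ord0; under eq_fun do rewrite big_ord0; exact: has_expect_cst.
rewrite big_ord_recr/=; under eq_fun do rewrite big_ord_recr/=.
by apply: has_expectD => //; exact: IH.
Qed.

Lemma has_expect_le f g x y : (forall a, f a <= g a) ->
  has_expect f x -> has_expect g y -> x <= y.
Proof.
move=> fg [fi fx] [gi gy]; rewrite -lee_fin -fx -gy.
by apply: le_integral => // a _; rewrite lee_fin.
Qed.

Lemma ge0_has_expect f x : measurable_fun setT f -> (forall a, 0 <= f a) ->
  (\int[P]_a (f a)%:E = x%:E)%E -> has_expect f x.
Proof.
move=> mf f0 fx; split => //; apply/integrableP; split.
  exact/measurable_EFinP.
under eq_integral do rewrite /= ger0_norm//.
by rewrite fx ltry.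
Qed.

Lemma integrable_has_expect f : P.-integrable setT (EFin \o f) ->
  has_expect f (fine (\int[P]_a (f a)%:E)).
Proof. by move=> fi; split => //; rewrite fineK//; exact: integrable_fin_num. Qed.

End expectation_value.

Section environment_integrals.
Context d (T : measurableType d) (R : realType) (P : probability T R).

Lemma integral_law (nu : probability (seqT R) R) (h : T -> seqT R) (f : seqT R -> R) :
  measurable_fun setT f ->
  (forall g : seqT R -> R, measurable_fun setT g -> (forall a, 0 <= g a) ->
     (\int[P]_x (g (h x))%:E = \int[nu]_a (g a)%:E)%E) ->
  (\int[P]_x (f (h x))%:E = \int[nu]_a (f a)%:E)%E.
Proof.
move=> mf hE.
rewrite (integralE P) (integralE nu).
congr (_ - _)%E.
  transitivity (\int[P]_x (f^\+ (h x))%:E)%E.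
    by apply: eq_integral => x _; rewrite funeposE EFin_max.
  rewrite hE; last 2 first.
  - exact: measurable_funrpos.
  - by move=> a; exact: funrpos_ge0.
  by apply: eq_integral => x _; rewrite funeposE EFin_max.
transitivity (\int[P]_x (f^\- (h x))%:E)%E.
  by apply: eq_integral => x _; rewrite funenegE EFin_max.
rewrite hE; last 2 first.
- exact: measurable_funrneg.
- by move=> a; exact: funrneg_ge0.
by apply: eq_integral => x _; rewrite funenegE EFin_max.
Qed.

End environment_integrals.

Section shift_invariance.
Variables (R : realType) (nu : probability (seqT R) R) (mu : set R -> \bar R).
Hypothesis nu_cylinder : forall n (B : nat -> set R),
  (forall i, measurable (B i)) -> nu (cylinder n B) = (\prod_(i < n) mu (B i))%E.

Lemma has_expect_shift k (f : seqT R -> R) x : has_expect nu f x ->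
  has_expect nu (fun a => f (shift k a)) x.
Proof.
move=> [fi fx]; have /integrableP[/measurable_EFinP mf flt] := fi.
have inv (g : seqT R -> R) : measurable_fun setT g -> (forall a, 0 <= g a) ->
     (\int[nu]_x (g (shift k x))%:E = \int[nu]_a (g a)%:E)%E.
  by move=> mg g0; exact: (integral_shift nu_cylinder).
split; last by rewrite (integral_law mf inv).
apply/integrableP; split.
  by apply/measurable_EFinP; exact: measurableT_comp mf (measurable_shift _).
rewrite (_ : (\int[nu]_a _)%E = \int[nu]_a (`|f (shift k a)|)%:E)%E//.
rewrite (inv (fun a => `|f a|))//.
exact: measurableT_comp.
Qed.

End shift_invariance.

(** * Fractional moments and the mean of the logarithm *)

Section hierarchical_logarithm.
Variables (R : realType) (s : nat) (b : R) (A : R -> R).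
Hypotheses (s_gt1 : (1 < s)%N) (b_gt1 : 1 < b).
Hypotheses (mA : measurable_fun setT A) (A_gt0 : forall t, 0 < A t).
Variables (nu : probability (seqT R) R) (mu : set R -> \bar R).
Hypothesis nu_cylinder : forall n (B : nat -> set R),
  (forall i, measurable (B i)) -> nu (cylinder n B) = (\prod_(i < n) mu (B i))%E.
Local Notation E f := (\int[nu]_a (f a)%:E)%E.
Local Notation E1 w := (\int[nu]_a (w (a 0%N : R))%:E)%E.
Local Notation Rn := (Rn s b A).

Let s_gt0 : (0 < s)%N. Proof. exact: ltn_trans s_gt1. Qed.
Let A_ge0 t : 0 <= A t. Proof. exact: ltW. Qed.
Let b_gt0 : 0 < b. Proof. exact: lt_trans b_gt1. Qed.
Let R_gt0 n a : 0 < Rn n a. Proof. exact: Rn_gt0. Qed.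
Let mR n : measurable_fun setT (Rn n). Proof. exact: measurable_Rn. Qed.
Let m0 := (b - 1) / b.
Let m0_gt0 : 0 < m0. Proof. by rewrite divr_gt0// subr_gt0. Qed.
Let lnR_lb n a : ln m0 <= ln (Rn n a).
Proof. by rewrite ler_ln ?posrE//; exact: Rn_lb. Qed.

Lemma expect_hier_le N (f : seqT R -> R) (w : R -> R) (x y : R) :
  measurable_fun setT f -> measurable_fun setT w ->
  (forall a, 0 <= f a) -> (forall t, 0 <= w t) -> depends_below N f ->
  (E f <= x%:E)%E -> (E1 w <= y%:E)%E ->
  exists2 z, E (hier s N f w) = z%:E & z <= x ^+ s * y ^+ s.-1.
Proof.
move=> mf mw f0 w0 df fx wy.
have [x' Ex /andP[x'0 x'x]] := expect_le_fine f0 fx.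
have [y' Ey /andP[y'0 y'y]] := expect_le_fine (fun a : seqT R => w0 (a 0%N)) wy.
exists (x' ^+ s * y' ^+ s.-1); first exact: (integral_hier nu_cylinder s mf mw f0 w0 df Ex Ey).
by rewrite ler_pM ?exprn_ge0// lerXn2r// nnegrE// (le_trans _ x'x, le_trans _ y'y).
Qed.

(** A ratio [t = z / (x + y)] in the unit interval satisfies [t <= t ^ p]; the cases [z = x] and
    [z = y] add up to the claim. *)
Lemma powR_subadd (x y p : R) : 0 <= x -> 0 <= y -> 0 < p -> p <= 1 ->
  (x + y) `^ p <= x `^ p + y `^ p.
Proof.
move=> x0 y0 p0 p1.
have [->|xn0] := eqVneq x 0; first by rewrite add0r lerDr powR_ge0.
have [->|yn0] := eqVneq y 0; first by rewrite addr0 lerDl powR_ge0.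
have xp : 0 < x by rewrite lt_neqAle eq_sym xn0.
have yp : 0 < y by rewrite lt_neqAle eq_sym yn0.
have xy : 0 < x + y by rewrite addr_gt0.
have h z : 0 < z -> z <= x + y -> z / (x + y) * (x + y) `^ p <= z `^ p.
  move=> z0 zxy; rewrite -{2}[z](@divfK _ (x + y)) ?gt_eqF//.
  rewrite powRM ?divr_ge0 ?(ltW z0) ?(ltW xy)//.
  rewrite ler_pM2r ?powR_gt0//; apply: ger1_powR => //.
  by rewrite divr_gt0//= ler_pdivrMr// mul1r.
rewrite -[leLHS]mul1r -[X in X * _ <= _](@divff _ (x + y)) ?gt_eqF//.
by rewrite mulrDl mulrDl lerD// h// (lerDl, lerDr) ltW.
Qed.

Lemma powR_prod (p : R) k (f : 'I_k -> R) : (forall i, 0 <= f i) ->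
  (\prod_(i < k) f i) `^ p = \prod_(i < k) f i `^ p.
Proof.
elim: k f => [|k IH] f f0; first by rewrite !big_ord0 powR1.
by rewrite !big_ord_recr/= powRM ?prodr_ge0// IH.
Qed.

(** Subadditivity of the power [p] separates [b - 1] from the product, which then factorizes; this
    closes the recursion of fractional moments as an inequality. *)
Lemma expect_Rn_powR n (p x y : R) : 0 < p -> p <= 1 ->
  (E (fun a => Rn n a `^ p) <= x%:E)%E -> (E1 (fun t => A t `^ p) <= y%:E)%E ->
  (E (fun a => Rn n.+1 a `^ p) <=
    ((x ^+ s * y ^+ s.-1 + (b - 1) `^ p) / b `^ p)%:E)%E.
Proof.
move=> p0 p1 Ex Ey.
have mRp m : measurable_fun setT (fun a => Rn m a `^ p).
  exact: measurableT_comp (measurable_powR p) (mR m).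
have mAp : measurable_fun setT (fun t => A t `^ p).
  exact: measurableT_comp (measurable_powR p) mA.
have dRp : depends_below (s ^ n - 1) (fun a => Rn n a `^ p).
  by move=> a a' h; rewrite (Rn_depends b A s_gt0 h).
have [z Ez zle] := expect_hier_le (mRp n) mAp (fun a => powR_ge0 _ _)
  (fun t => powR_ge0 _ _) dRp Ex Ey.
have b1 : 0 <= b - 1 by rewrite subr_ge0 ltW.
have mF := measurable_hier s (s ^ n - 1) (mRp n) mAp.
have F0 a : 0 <= hier s (s ^ n - 1) (fun a => Rn n a `^ p) (fun t => A t `^ p) a.
  by apply: hier_ge0 => *; exact: powR_ge0.
apply: (@le_trans _ _ (E (fun a => (b `^ p)^-1 *
   hier s (s ^ n - 1) (fun a => Rn n a `^ p) (fun t => A t `^ p) a +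
   (b `^ p)^-1 * (b - 1) `^ p))).
  apply: expect_le => //.
  - apply: measurable_funD; last exact: measurable_cst.
    by apply: measurable_funM => //; exact: measurable_cst.
  - by move=> a; exact: powR_ge0.
  move=> a; rewrite RnS -addrA -mulrDr mulrC powRM; last 2 first.
  - by rewrite invr_ge0 ltW.
  - by rewrite addr_ge0// hier_ge0// => *; exact: ltW.
  rewrite -powR_inv1 ?(ltW b_gt0)// -powRrM mulN1r powRN ler_pM2l ?invr_gt0 ?powR_gt0//.
  apply: (le_trans (powR_subadd _ _ p0 p1)) => //.
    by rewrite hier_ge0// => *; exact: ltW.
  rewrite lerD2r /hier powRM; last 2 first.
  - by rewrite prodr_ge0// => *; exact: ltW.
  - by rewrite prodr_ge0// => *; exact: ltW.
  by rewrite !powR_prod// => *; exact: ltW.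
rewrite (expect_affine mF F0 _ _ Ez) ?mulr_ge0 ?invr_ge0 ?powR_ge0//.
by rewrite lee_fin -mulrDr [leRHS]mulrC ler_pM2l ?invr_gt0 ?powR_gt0// lerD2r.
Qed.

(** Domination by [Rn n + |ln m0|]: the logarithm lies below the identity, and [Rn_lb] bounds it
    from below. *)
Lemma lnR_integrable n r : E (Rn n) = r%:E ->
  nu.-integrable setT (EFin \o (fun a => ln (Rn n a))).
Proof.
move=> Er.
have [Ri _] := has_expectD (ge0_has_expect (mR n) (fun a => ltW (R_gt0 n a)) Er)
  (has_expect_cst nu `|ln m0|).
apply: le_integrable Ri => //.
  by apply/measurable_EFinP; exact: measurableT_comp (@measurable_ln R) (mR n).
move=> a _; rewrite /= lee_fin [leRHS]ger0_norm ?addr_ge0 ?(ltW (R_gt0 _ _))//.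
rewrite ler_norml; apply/andP; split.
  have := lnR_lb n a; have := R_gt0 n a; have := ler_norm (- ln m0).
  by rewrite normrN; lra.
by rewrite (le_trans (ltW (ln_sublinear (R_gt0 n a))))// lerDl.
Qed.

Definition mean_log n : R := fine (E (fun a => ln (Rn n a))).

Lemma mean_log_ge n r : E (Rn n) = r%:E -> ln m0 <= mean_log n.
Proof.
move=> Er; apply: (has_expect_le (lnR_lb n) (has_expect_cst nu _)).
exact: integrable_has_expect (lnR_integrable Er).
Qed.

(** Jensen's inequality, obtained by integrating the tangent line of [ln] at [r]. *)
Lemma mean_log_le n r : 0 < r -> E (Rn n) = r%:E -> mean_log n <= ln r.
Proof.
move=> r0 Er.
have Rr := ge0_has_expect (mR n) (fun a => ltW (R_gt0 n a)) Er.
have := has_expectD (has_expect_cst nu (ln r - 1)) (has_expectZ r^-1 Rr).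
rewrite mulVf ?gt_eqF// subrK => h.
apply: (has_expect_le _ (integrable_has_expect (lnR_integrable Er)) h) => a.
rewrite -[X in ln X](@divfK _ r) ?gt_eqF// lnM ?posrE ?divr_gt0//.
have : -1 < Rn n a / r - 1 by rewrite -subr_gt0 opprK subrK divr_gt0.
move=> /le_ln1Dx; rewrite addrCA subrr addr0 mulrC => ?; lra.
Qed.

Lemma mean_log_le0 n p r : 0 < p -> E (Rn n) = r%:E ->
  (E (fun a => Rn n a `^ p) <= 1%:E)%E -> mean_log n <= 0.
Proof.
move=> p0 Er le1.
have [z Ez /andP[z0 z1]] := expect_le_fine (fun a => powR_ge0 (Rn n a) p) le1.
have mRp : measurable_fun setT (fun a => Rn n a `^ p).
  exact: measurableT_comp (measurable_powR p) (mR n).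
have h := has_expectD (ge0_has_expect mRp (fun a => powR_ge0 _ _) Ez)
  (has_expect_cst nu (-1)).
have h' := has_expectZ p (integrable_has_expect (lnR_integrable Er)).
have : p * mean_log n <= z - 1.
  apply: (has_expect_le _ h' h) => a.
  rewrite -ln_powR -{1}[_ `^ p](subrK 1) addrC le_ln1Dx//.
  by rewrite -subr_gt0 opprK subrK powR_gt0.
by move=> pl; rewrite -(pmulr_rle0 _ p0) (le_trans pl)// subr_le0.
Qed.

(** With [z = Rn / r], one has [ln z >= 1 - 1 / z = (z - 1) - (z - 1) ^ 2 / z], and
    [1 / z <= r / m0] by the floor on [Rn]. In the mean the linear term vanishes and the quadratic
    one is the relative variance. *)
Lemma mean_log_ge_second_moment n r v : 0 < r -> E (Rn n) = r%:E ->
  E (fun a => Rn n a ^+ 2) = v%:E ->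
  ln r - (v / r ^+ 2 - 1) * (r / m0) <= mean_log n.
Proof.
move=> r0 Er Ev.
have Rr := ge0_has_expect (mR n) (fun a => ltW (R_gt0 n a)) Er.
have mR2 : measurable_fun setT (fun a => Rn n a ^+ 2) by exact: measurable_funX.
have R2 := ge0_has_expect mR2 (fun a => sqr_ge0 _) Ev.
pose k := r / m0; have k0 : 0 < k by rewrite divr_gt0.
(* This is [ln r + (z - 1) - k * (z - 1) ^ 2] expanded in powers of [Rn n]. *)
have := has_expectD (has_expect_cst nu (ln r - 1 - k))
  (has_expectD (has_expectZ ((1 + 2 * k) / r) Rr) (has_expectZ (- k / r ^+ 2) R2)).
rewrite (_ : ln r - 1 - k + ((1 + 2 * k) / r * r + - k / r ^+ 2 * v) =
  ln r - (v / r ^+ 2 - 1) * k); last by field; rewrite gt_eqF.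
move=> h; apply: (has_expect_le _ h (integrable_has_expect (lnR_integrable Er))) => a.
set X := Rn n a; have X0 : 0 < X by exact: R_gt0.
pose z := X / r; have z0 : 0 < z by rewrite divr_gt0.
have -> : X = z * r by rewrite /z divfK// gt_eqF.
have zk : z^-1 <= k.
  rewrite /z /k invf_div ler_pM2l// lef_pV2 ?posrE//; exact: Rn_lb.
rewrite lnM ?posrE//.
have lz : 1 - z^-1 <= ln z.
  have : -1 < z^-1 - 1 by rewrite -subr_gt0 opprK subrK invr_gt0.
  move=> /le_ln1Dx; rewrite addrCA subrr addr0 lnV ?posrE// => ?; lra.
have e : 1 - z^-1 = (z - 1) - (z - 1) ^+ 2 * z^-1 by field; rewrite gt_eqF.
have : (z - 1) ^+ 2 * z^-1 <= (z - 1) ^+ 2 * k by rewrite ler_wpM2l ?sqr_ge0.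
rewrite (_ : _ / r * (z * r) = (1 + 2 * k) * z); last by field; rewrite gt_eqF.
rewrite (_ : - k / r ^+ 2 * (z * r) ^+ 2 = - k * z ^+ 2); last by field; rewrite gt_eqF.
rewrite e in lz; rewrite !expr2 in lz *; move: lz; lra.
Qed.

(** Dropping [b - 1 >= 0] leaves [Rn n.+1] above its product divided by [b], whose logarithm is a
    sum over blocks and extra sites. *)
Lemma mean_log_superadditive n r r' e : E (Rn n) = r%:E -> E (Rn n.+1) = r'%:E ->
  has_expect nu (fun a => ln (A (a 0%N))) e ->
  s%:R * mean_log n + s.-1%:R * e - ln b <= mean_log n.+1.
Proof.
move=> Er Er' he.
have hR := integrable_has_expect (lnR_integrable Er).
have hR' := integrable_has_expect (lnR_integrable Er').
have h1 := has_expect_sum (fun j : 'I_s => has_expect_shift nu_cylinder (j * (s ^ n - 1)) hR).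
have h2 := has_expect_sum (fun j : 'I_s.-1 =>
  has_expect_shift nu_cylinder (s * (s ^ n - 1) + j) he).
have h := has_expectD (has_expectD h1 h2) (has_expect_cst nu (- ln b)).
rewrite !sumr_const !card_ord -(mulr_natl _ s) -(mulr_natl _ s.-1) in h.
apply: (has_expect_le _ h hR') => a.
have H0 : 0 < hier s (s ^ n - 1) (Rn n) A a by rewrite mulr_gt0// prodr_gt0.
apply: (@le_trans _ _ (ln (hier s (s ^ n - 1) (Rn n) A a / b))).
  rewrite ln_div ?posrE// lerD2r /hier lnM ?posrE ?prodr_gt0//.
  have lnp k (f : 'I_k -> R) : (forall i, 0 < f i) ->
      ln (\prod_(i < k) f i) = \sum_(i < k) ln (f i).
    elim: k f => [|k IH] f f0; first by rewrite !big_ord0 ln1.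
    by rewrite !big_ord_recr/= lnM ?posrE ?prodr_gt0// IH.
  rewrite !lnp// lerD//; apply: ler_sum => j _ //.
  by rewrite /shift addn0.
rewrite RnS ler_ln ?posrE ?divr_gt0//; last first.
  by rewrite -addrA addr_gt0// subr_gt0.
by rewrite ler_pM2r ?invr_gt0// -addrA lerDl subr_ge0 ltW.
Qed.

End hierarchical_logarithm.

(** * Deterministic recursions *)

Section real_inequalities.
Variable R : realType.
Implicit Types x y z t : R.

(** From [expR z <= 1 / (1 - z)] and [(1 - z) * (1 + z + 2 * z ^ 2) = 1 + z ^ 2 * (1 - 2 * z)];
    negative [z] of any size is allowed. *)
Lemma expR_le_quad z : z <= 1 / 2 -> expR z <= 1 + z + 2 * z ^+ 2.
Proof.
move=> z2; have e : 1 - z <= expR (- z) by rewrite expR_ge1Dx.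
have z1 : 0 < 1 - z by lra.
rewrite -[z in expR z]opprK expRN.
apply: (@le_trans _ _ (1 - z)^-1); first by rewrite lef_pV2 ?posrE ?expR_gt0.
rewrite -[_^-1]mul1r ler_pdivrMr//.
have : 0 <= z ^+ 2 * (1 - 2 * z) by rewrite mulr_ge0 ?sqr_ge0//; lra.
by rewrite !expr2; nra.
Qed.

Lemma expRN_le_quad t : 0 <= t -> expR (- t) <= 1 - t + t ^+ 2.
Proof.
move=> t0; rewrite expRN -[_^-1]mul1r ler_pdivrMr ?expR_gt0//.
apply: (@le_trans _ _ ((1 - t + t ^+ 2) * (1 + t))).
  have : 0 <= t ^+ 3 by rewrite exprn_ge0.
  by rewrite !exprS expr0; nra.
by rewrite ler_wpM2l ?expR_ge1Dx//; nra.
Qed.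

Lemma exprn_1D_le x n : 0 <= 1 + x -> (1 + x) ^+ n <= expR (n%:R * x).
Proof.
by move=> x0; rewrite expRM_natl lerXn2r ?nnegrE ?expR_ge0// expR_ge1Dx.
Qed.

Lemma bernoulli_exprn x n : 0 <= x -> 1 + n%:R * x <= (1 + x) ^+ n.
Proof.
move=> x0; elim: n => [|n IH]; first by rewrite mul0r addr0 expr0.
rewrite exprS; apply: (@le_trans _ _ ((1 + x) * (1 + n%:R * x))); last first.
  by rewrite ler_wpM2l//; lra.
have : 0 <= n%:R * x * x by rewrite !mulr_ge0.
by rewrite -natr1; nra.
Qed.

(** Young's inequality with exponents [1 / p] and [k + 1], [p = k / (k + 1)], for the factors
    [(x * g) ^ p] and [g ^ (- p)]. This form of [p] makes the last term an integer power of [1 / g],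
    which factorizes over sites. *)
Lemma powR_young x g k : 0 <= x -> 0 < g ->
  x `^ (k%:R / k.+1%:R) <= k%:R / k.+1%:R * (x * g) + k.+1%:R^-1 * (g^-1) ^+ k.
Proof.
move=> x0 g0; have k1 : 0 < k.+1%:R :> R by rewrite ltr0n.
have [->|kn0] := posnP k.
  by rewrite !mul0r add0r powRr0 expr0 invr1 mulr1.
have k0 : 0 < k%:R :> R by rewrite ltr0n.
have gi : 0 < g^-1 by rewrite invr_gt0.
set p := k%:R / k.+1%:R.
have p0 : 0 < p by rewrite divr_gt0.
have := @conjugate_powR R ((x * g) `^ p) ((g^-1) `^ p) p^-1 k.+1%:R
  (powR_ge0 _ _) (powR_ge0 _ _).
rewrite invr_gt0 p0 k1 => /(_ isT isT).
rewrite invrK -!powRrM mulfV ?gt_eqF// powRr1 ?mulr_ge0 ?(ltW g0)//.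
rewrite /p divfK ?gt_eqF// powR_mulrn ?(ltW gi)// -powRM ?mulr_ge0 ?(ltW g0) ?(ltW gi)//.
rewrite mulfK ?gt_eqF// => h.
have {}h := h _; move: h.
rewrite -[X in _ + X]mul1r -mulrDl natr1 divff ?gt_eqF// => /(_ erefl) h.
by rewrite [_ / _ * (x * g)]mulrC [_ * g^-1 ^+ k]mulrC.
Qed.

End real_inequalities.

(** * Limits under rescaling by the system size, and choice of the fractional exponent *)

Section limits.
Variables (R : realType) (s : nat).
Hypothesis s_gt1 : (1 < s)%N.
Implicit Types u : nat -> R.

Let sR_gt1 : 1 < s%:R :> R. Proof. by rewrite ltr1n. Qed.
Let sR_gt0 : 0 < s%:R :> R. Proof. exact: lt_trans sR_gt1. Qed.
Let sn_gt0 n : 0 < (s ^ n)%:R :> R.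
Proof. by rewrite ltr0n expn_gt0 (ltn_trans _ s_gt1). Qed.

Lemma cvg_div_expn (c : R) : (c / (s ^ n)%:R @[n --> \oo] --> (0 : R)).
Proof.
have lt1 : `|s%:R^-1 : R| < 1.
  by rewrite ger0_norm ?invr_ge0 ?ler0n// invf_lt1.
have := cvg_geometric c lt1.
apply: cvg_trans; apply: near_eq_cvg; near=> n.
by rewrite /geometric/= natrX exprVn.
Unshelve. all: by end_near. Qed.

Lemma lim_div_expn_eq0 u (K : R) n0 : (forall n, - K <= u n) ->
  (forall n, (n0 <= n)%N -> u n <= 0) -> limn (fun n => u n / (s ^ n)%:R) = 0.
Proof.
move=> lb ub; apply/cvg_lim => //.
apply: (@squeeze_cvgr _ _ _ _ (fun n => - K / (s ^ n)%:R) (fun=> 0)).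
- near=> n; rewrite ler_pM2r ?invr_gt0// lb/= pmulr_lle0 ?invr_gt0//.
  by apply: ub; near: n; exact: nbhs_infty_ge.
- exact: cvg_div_expn.
- exact: cvg_cst.
Unshelve. all: by end_near. Qed.

(** Adding [c] turns the hypothesis into [s * (u n + c) <= u n.+1 + c], so [(u n + c) / s ^ n] is
    nondecreasing; it is bounded, hence its limit is at least its positive value at [n0], and
    [c / s ^ n] vanishes. *)
Lemma lim_superadditive_gt0 u (c H : R) n0 :
  (forall n, s%:R * u n + s.-1%:R * c <= u n.+1) ->
  (forall n, u n <= H * (s ^ n)%:R) -> 0 < u n0 + c ->
  0 < limn (fun n => u n / (s ^ n)%:R).
Proof.
move=> sup ub pos.
pose v n := (u n + c) / (s ^ n)%:R.
have nd : {homo v : n m / (n <= m)%N >-> n <= m}.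
  apply: homo_leq => // [x y z xy /(le_trans xy)//|n].
  rewrite /v expnS natrM invfM mulrA ler_pM2r ?invr_gt0//.
  rewrite ler_pdivlMr ?(lt_trans _ sR_gt1)//.
  have := sup n; have -> : s%:R = s.-1%:R + 1 :> R.
    by rewrite natr1 prednK// (ltn_trans _ s_gt1).
  by lra.
have ubv : has_ubound (range v).
  exists (H + `|c|) => _ [n _ <-]; rewrite /v ler_pdivrMr// mulrDl lerD//.
  apply: (le_trans (ler_norm _)); rewrite ler_peMr//.
  by rewrite ler1n expn_gt0 (ltn_trans _ s_gt1).
have cv := nondecreasing_is_cvgn nd ubv.
have le := nondecreasing_cvgn_le nd cv n0.
apply: (@lt_le_trans _ _ (v n0)); first by rewrite divr_gt0.
suff -> : limn (fun n => u n / (s ^ n)%:R) = limn v by [].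
apply/cvg_lim => //.
have -> : (fun n => u n / (s ^ n)%:R) = v - (fun n => c / (s ^ n)%:R).
  by apply/funext => n; rewrite /v fctE mulrDl addrK.
rewrite -[X in _ --> X]subr0; apply: cvgB => //; exact: cvg_div_expn.
Qed.

(** The exponent tends to 1 with [k], so the strict inequality at exponent 1 persists for large [k].
    Asking [3 <= k] makes the conjugate weight [1 / (k + 1)] at most 1/4. *)
Lemma exists_exponent (b v : R) : 1 < b -> (1 - v) ^+ s + (b - 1) < b * (1 - v) ->
  exists2 k, (3 <= k)%N & (1 - v) ^+ s + (b - 1) `^ (k%:R / k.+1%:R) <
    b `^ (k%:R / k.+1%:R) * (1 - v).
Proof.
move=> b1 lt.
have cv (x : R) : 0 < x -> x `^ (k%:R / k.+1%:R) @[k --> \oo] --> x.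
  move=> x0.
  have -> : (fun k => x `^ (k%:R / k.+1%:R)) =
     (fun k => expR ((1 - k.+1%:R^-1) * ln x)).
    apply/funext => k; rewrite -[in LHS](@lnK _ x) ?posrE// -expRM mulrC.
    have -> : k%:R / k.+1%:R = 1 - k.+1%:R^-1 :> R.
      by rewrite -[in LHS](addrK 1 k%:R) natr1 mulrBl divff ?mul1r// pnatr_eq0.
    by [].
  rewrite -[X in _ --> X](@lnK _ x) ?posrE//.
  apply: continuous_cvg; first exact: continuous_expR.
  rewrite -[X in _ --> X]mul1r; apply: cvgM; last exact: cvg_cst.
  rewrite -[X in _ --> X]subr0; apply: cvgB; [exact: cvg_cst|exact: cvg_harmonic].
have cvF : b `^ (k%:R / k.+1%:R) * (1 - v) - (b - 1) `^ (k%:R / k.+1%:R)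
    @[k --> \oo] --> b * (1 - v) - (b - 1).
  apply: cvgB; last by apply: cv; rewrite subr_gt0.
  by apply: cvgM; [apply: cv; exact: lt_trans b1|exact: cvg_cst].
have : \forall k \near \oo, (1 - v) ^+ s <
    b `^ (k%:R / k.+1%:R) * (1 - v) - (b - 1) `^ (k%:R / k.+1%:R).
  apply: (cvgr_gt _ cvF); lra.
case=> N _ hN; exists (maxn 3 N); first exact: leq_maxl.
by have := hN (maxn 3 N) (leq_maxr _ _); rewrite /=; lra.
Qed.

End limits.

(** * Decay of the tilted mean along levels *)

Section descent.
Variables (R : realType) (s n : nat) (b alpha : R) (rho y : nat -> R).
Hypotheses (b_gt1 : 1 < b) (b_sqr : b ^+ 2 = s%:R).
Hypotheses (alpha_gt0 : 0 < alpha) (alpha_small : 2 * s%:R * alpha <= b - 1).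
Hypotheses (rho_ge0 : forall m, 0 <= rho m) (y_ge0 : forall m, 0 <= y m).
Hypotheses (rho0 : rho 0%N = 1)
  (rhoS : forall m, rho m.+1 = (rho m ^+ s * y m ^+ s.-1 + b - 1) / b)
  (y_small : forall m, (m < n)%N ->
     y m ^+ s.-1 <= expR (- (alpha * s%:R / n%:R * (b ^+ m / b ^+ n)))).

(* The linearised recursion for 1 - rho m is solved by
   alpha * (m / n) * b ^ (m - n); the factor 1 - D * b ^ (m - n) absorbs the
   quadratic corrections. *)
Lemma tilted_mean_le : (0 < n)%N -> rho n <= 1 - alpha / 2.
Proof.
have := b_gt1; have := b_sqr; have := alpha_gt0; have := alpha_small.
move=> alpha_s alpha_g b_s b_g n_gt0; have n0 : 0 < n%:R :> R by rewrite ltr0n.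
have b0 : 0 < b by exact: lt_trans b_gt1.
pose B m : R := b ^+ m / b ^+ n.
have B0 m : 0 < B m by rewrite divr_gt0// exprn_gt0.
have BS m : B m.+1 = b * B m by rewrite /B exprS mulrA.
have B1 m : (m <= n)%N -> B m <= 1.
  by move=> mn; rewrite ler_pdivrMr ?exprn_gt0// mul1r ler_eXn2l.
pose L m : R := alpha * (m%:R / n%:R) * B m.
pose D : R := s%:R * alpha / (b - 1).
have b10 : 0 < b - 1 by rewrite subr_gt0.
have D0 : 0 <= D by rewrite divr_ge0 ?mulr_ge0 ?ler0n ?ltW.
have D2 : D <= 1 / 2.
  by rewrite ler_pdivrMr//; lra.
pose c m : R := 1 - D * B m.
suff H m : (m <= n)%N -> rho m <= 1 - L m * c m.
  apply: (le_trans (H n (leqnn n))); rewrite /L /c /B !divff ?gt_eqF ?exprn_gt0//.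
  by have := alpha_g; nra.
elim: m => [|m IH] mn; first by rewrite rho0 /L mul0r mulr0 !mul0r subr0.
have {}IH := IH (ltnW mn).
have c0 : 0 <= c m.
  have : D * B m <= 1 / 2 * 1 by apply: ler_pM => //; [exact: ltW|exact: B1 (ltnW mn)].
  by rewrite /c; lra.
have c1 : c m <= 1 by rewrite /c; have := mulr_ge0 D0 (ltW (B0 m)); lra.
have L0 k : 0 <= L k.
  by apply: mulr_ge0 (ltW (B0 k)); rewrite mulr_ge0 ?(ltW alpha_gt0)// divr_ge0 ?ler0n.
have LB : L m.+1 <= alpha * B m.+1.
  rewrite /L ler_pM2r// -[leRHS]mulr1 ler_pM2l// ler_pdivrMr// mul1r ler_nat//.
pose t := c m * (b * L m.+1).
have t0 : 0 <= t by apply: mulr_ge0 => //; apply: mulr_ge0 => //; exact: ltW.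
(* Marginality enters here: because [b ^ 2 = s], [L] solves the linearised recursion exactly. *)
have tE : b * L m.+1 = s%:R * L m + alpha * s%:R / n%:R * B m.
  by rewrite /L BS -natr1 -b_sqr; field; rewrite gt_eqF.
have step : rho m ^+ s * y m ^+ s.-1 <= expR (- t).
  apply: (@le_trans _ _ (expR (s%:R * (- (L m * c m))) *
      expR (- (alpha * s%:R / n%:R * B m)))).
    apply: ler_pM; rewrite ?exprn_ge0//; last exact: y_small.
    apply: le_trans (exprn_1D_le _ _); last exact: le_trans IH.
    by rewrite lerXn2r ?nnegrE// (le_trans _ IH).
  rewrite -expRD ler_expR /t tE.
  have : 0 <= alpha * s%:R / n%:R * B m.
    by apply: mulr_ge0 (ltW (B0 m)); rewrite divr_ge0 ?ler0n// mulr_ge0 ?ler0n// ltW.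
  by nra.
have {}step : rho m ^+ s * y m ^+ s.-1 <= 1 - t + t ^+ 2.
  exact: le_trans step (expRN_le_quad t0).
rewrite rhoS ler_pdivrMr//.
have tle : t <= b * L m.+1.
  by rewrite /t -[leRHS]mul1r ler_wpM2r// mulr_ge0// ltW.
(* [D] was chosen with [D * (b - 1) = s * alpha], so passing from [B m] to [B m.+1] lowers [c] by
   [s * alpha * B m], which dominates [b * L m.+1]. *)
have key : c m.+1 <= c m - b * L m.+1.
  have : b * L m.+1 <= b * (alpha * B m.+1) by rewrite ler_pM2l.
  have Db : D * (b - 1) = s%:R * alpha by rewrite /D divfK// gt_eqF.
  rewrite /c BS.
  have : b * (alpha * (b * B m)) = D * (b - 1) * B m by rewrite Db -b_sqr; ring.
  by lra.
(* Multiplied by [b * L m.+1], the right side becomes [t - t ^ 2], exactly the decrease provided by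
   the quadratic bound [step]. *)
have key2 : c m.+1 <= c m * (1 - t).
  have : c m * t <= b * L m.+1 by rewrite (le_trans _ tle)// ler_piMl.
  by nra.
have := ler_wpM2l (mulr_ge0 (ltW b0) (L0 m.+1)) key2.
have -> : b * L m.+1 * (c m * (1 - t)) = t - t ^+ 2 by rewrite /t; ring.
by lra.
Qed.

End descent.

(** * Growth of the mean and of the relative variance *)

Section second_moment_growth.
Variables (R : realType) (s : nat) (b C K : R).
Hypotheses (s_gt1 : (1 < s)%N) (b_gt1 : 1 < b) (b_sqr : b ^+ 2 = s%:R).
Hypotheses (C_ge0 : 0 <= C) (K_gt1 : 1 < K).

Let b0 : 0 < b. Proof. exact: lt_trans b_gt1. Qed.
Let sR : 1 < s%:R :> R. Proof. by rewrite ltr1n. Qed.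
Let s1E : s%:R = s.-1%:R + 1 :> R.
Proof. by rewrite natr1 prednK// (ltn_trans _ s_gt1). Qed.

(** The second term absorbs the remainder [2 * t ^ 2] of the exponential for
    [t <= s * (1 + C) * beta], after division by [s]. *)
Let C3 : R := C + 2 * s%:R * (1 + C) ^+ 2.
Let C3_gt0 : 0 < C3.
Proof.
have Cg := C_ge0; have s0 : 0 < s%:R :> R by exact: lt_trans sR.
by rewrite /C3 ltr_wpDl// !mulr_gt0//; lra.
Qed.

Section fixed_parameters.
Variables (beta h q : R) (r v : nat -> R).
Hypotheses (beta_gt0 : 0 < beta) (beta_small : 2 * (s%:R * (1 + C)) * beta <= 1)
  (h_gt0 : 0 < h) (q_ge0 : 0 <= q) (q_le : q <= 1 + C * beta ^+ 2).
Let X m : R := r m ^+ s * expR h ^+ s.-1.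
Hypotheses (r0 : r 0%N = 1) (rS : forall m, r m.+1 = (X m + b - 1) / b).
Hypotheses (v0 : v 0%N = 1) (v_ge0 : forall m, 0 <= v m)
  (vS : forall m, v m.+1 = (v m ^+ s * (q * expR h ^+ 2) ^+ s.-1 +
     2 * (b - 1) * X m + (b - 1) ^+ 2) / b ^+ 2).

(** Bernoulli gives [X m - 1 >= s * (r m - 1) + h], and dividing by [b] turns [s] into [b]. *)
Lemma mean_growth m : 1 <= r m /\
  b * (r m - 1) + h / b <= r m.+1 - 1.
Proof.
have bg := b_gt1; have Cg := C_ge0; have Kg := K_gt1; have sg := sR; have sE := s1E; have bp := b0.
have hg := h_gt0; have g k : 1 <= r k -> b * (r k - 1) + h / b <= r k.+1 - 1.
  move=> rk; pose u := r k - 1; have u0 : 0 <= u by rewrite subr_ge0.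
  have e1 : 1 + s%:R * u <= r k ^+ s.
    by rewrite -[X in _ <= X ^+ _](subrKC 1 (r k)) bernoulli_exprn.
  have e2 : 1 + h <= expR h ^+ s.-1.
    apply: (le_trans (expR_ge1Dx h)); rewrite -[leLHS]expr1 ler_weXn2l//.
      by rewrite -expR0 ler_expR ltW.
    by rewrite -subn1 subn_gt0.
  have e3 : (1 + s%:R * u) * (1 + h) <= X k.
    by apply: ler_pM => //; rewrite addr_ge0// ?mulr_ge0// ltW.
  have su : 0 <= s%:R * u * h by rewrite !mulr_ge0// ltW.
  have Xu : s%:R * u + h <= X k - 1 by nra.
  rewrite rS -/u -b_sqr in Xu *.
  have -> : (X k + b - 1) / b - 1 = (X k - 1) / b by field; rewrite gt_eqF.
  by rewrite ler_pdivlMr// mulrDl divfK ?gt_eqF// mulrAC -expr2.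
suff r1 k : 1 <= r k by split => //; exact: g.
elim: k => [|k IH]; first by rewrite r0.
have := g k IH; have : 0 <= b * (r k - 1) by rewrite mulr_ge0 ?subr_ge0// ltW.
have : 0 <= h / b by rewrite divr_ge0 ?ltW.
by lra.
Qed.

Lemma mean_lower_bound m : b ^+ m * (h / b) <= r m.+1 - 1.
Proof.
elim: m => [|m IH].
  by have [] := mean_growth 0; rewrite r0 subrr mulr0 add0r expr0 mul1r.
have [_] := mean_growth m.+1; apply: le_trans.
rewrite exprS -mulrA (le_trans (ler_wpM2l (ltW b0) IH))// lerDl.
by rewrite divr_ge0 ?ltW.
Qed.

(** The product has relative variance at most [s * (w + C3 * beta ^ 2)]. The terms without this
    excess assemble into [r m.+1 ^ 2 * b ^ 2]; dividing the excess by [b ^ 2 = s] leaves the squared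
    ratio [X m / r m.+1], where [X m = 1 + b * (r m.+1 - 1)], hence the exponential factor. *)
Lemma relative_variance_step m (w : R) : 0 <= w -> w <= beta ->
  v m <= (1 + w) * r m ^+ 2 ->
  v m.+1 <= (1 + expR (2 * (b - 1) * (r m.+1 - 1)) * (w + C3 * beta ^+ 2)) * r m.+1 ^+ 2.
Proof.
have bg := b_gt1; have Cg := C_ge0; have Kg := K_gt1; have sg := sR; have sE := s1E; have bp := b0.
have betag := beta_gt0; have betas := beta_small; have qg := q_ge0; have ql := q_le; have C3g := C3_gt0.
move=> w0 wb vle.
have [rm _] := mean_growth m; have [rm1 _] := mean_growth m.+1.
have X1 : 1 <= X m.
  have := rS m => /(congr1 (fun x => x * b)); rewrite divfK ?gt_eqF//.
  by move: rm1; rewrite -(ler_pM2r b0); lra.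
have X0 : 0 < X m by lra.
pose t := s%:R * w + s.-1%:R * (C * beta ^+ 2).
have b20 : 0 <= beta ^+ 2 by rewrite sqr_ge0.
have bb : beta ^+ 2 <= beta.
  have : beta <= 1.
    apply: le_trans beta_small; rewrite -[leLHS]mul1r ler_pM2r//.
    have := mulr_ge0 (ltW (lt_trans ltr01 sR)) C_ge0; lra.
  by rewrite expr2 => b1; rewrite -[leRHS]mulr1 ler_pM2l.
have s10 : 0 <= s.-1%:R :> R by rewrite ler0n.
have t0 : 0 <= t by rewrite addr_ge0// !mulr_ge0// ltW// (lt_trans _ sR).
have tle : t <= s%:R * (1 + C) * beta.
  have h1 : s%:R * w <= s%:R * beta by rewrite ler_pM2l// (lt_trans _ sR).
  have h2 : s.-1%:R * (C * beta ^+ 2) <= s%:R * (C * beta).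
    by apply: ler_pM => //; [rewrite mulr_ge0|lra|rewrite ler_wpM2l].
  by rewrite /t; lra.
have qe : (1 + w) ^+ s * q ^+ s.-1 <= expR t.
  rewrite expRD; apply: ler_pM; rewrite ?exprn_ge0//; [lra|apply: exprn_1D_le; lra|].
  apply: le_trans (exprn_1D_le _ _); last by rewrite addr_ge0// mulr_ge0.
  by rewrite lerXn2r ?nnegrE// addr_ge0// mulr_ge0.
have {}qe : (1 + w) ^+ s * q ^+ s.-1 - 1 <= s%:R * (w + C3 * beta ^+ 2).
  have := expR_le_quad (_ : t <= 1 / 2); rewrite (le_trans tle) => [/(_ isT) e|]; last by lra.
  have t2 : t ^+ 2 <= (s%:R * (1 + C) * beta) ^+ 2 by rewrite lerXn2r ?nnegrE// (le_trans t0).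
  have cc : s.-1%:R * (C * beta ^+ 2) <= s%:R * (C * beta ^+ 2).
    by rewrite ler_wpM2r ?mulr_ge0//; lra.
  have -> : s%:R * (w + C3 * beta ^+ 2) = s%:R * w + s%:R * (C * beta ^+ 2) +
    2 * (s%:R * (1 + C) * beta) ^+ 2 by rewrite /C3; ring.
  have tE : t = s%:R * w + s.-1%:R * (C * beta ^+ 2) by [].
  by move: qe; set Pq := (1 + w) ^+ s * _ => qe; lra.
have Vle : v m ^+ s * (q * expR h ^+ 2) ^+ s.-1 <= X m ^+ 2 * (1 + s%:R * (w + C3 * beta ^+ 2)).
  apply: (@le_trans _ _ (((1 + w) * r m ^+ 2) ^+ s * (q * expR h ^+ 2) ^+ s.-1)).
    rewrite ler_wpM2r ?exprn_ge0 ?mulr_ge0 ?sqr_ge0// lerXn2r ?nnegrE//.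
    by rewrite mulr_ge0 ?sqr_ge0//; lra.
  have -> : ((1 + w) * r m ^+ 2) ^+ s * (q * expR h ^+ 2) ^+ s.-1 =
     X m ^+ 2 * ((1 + w) ^+ s * q ^+ s.-1).
    by rewrite /X !exprMn; ring.
  by rewrite ler_pM2l ?exprn_gt0//; lra.
have XE : X m = b * (r m.+1 - 1) + 1 by rewrite rS; field; rewrite gt_eqF.
have rho : X m <= expR ((b - 1) * (r m.+1 - 1)) * r m.+1.
  apply: (@le_trans _ _ ((1 + (b - 1) * (r m.+1 - 1)) * r m.+1)); last first.
    by rewrite ler_wpM2r ?expR_ge1Dx//; lra.
  have : 0 <= (b - 1) * ((r m.+1 - 1) * (r m.+1 - 1)).
    by rewrite mulr_ge0 ?mulr_ge0 ?subr_ge0// ltW.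
  by rewrite XE; lra.
have rho2 : X m ^+ 2 <= expR (2 * (b - 1) * (r m.+1 - 1)) * r m.+1 ^+ 2.
  rewrite -mulrA expRM_natl -exprMn lerXn2r ?nnegrE ?(ltW X0)//.
  by rewrite mulr_ge0 ?expR_ge0//; lra.
set W := w + C3 * beta ^+ 2 in Vle *.
have W0 : 0 <= W by rewrite addr_ge0// mulr_ge0// ltW.
have E2 : r m.+1 ^+ 2 * b ^+ 2 = X m ^+ 2 + 2 * (b - 1) * X m + (b - 1) ^+ 2.
  by rewrite rS; field; rewrite gt_eqF.
have : X m ^+ 2 * (s%:R * W) <= expR (2 * (b - 1) * (r m.+1 - 1)) * r m.+1 ^+ 2 * (s%:R * W).
  by rewrite ler_wpM2r// mulr_ge0// ltW// (lt_trans _ sR).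
set e := expR _ => le; rewrite vS ler_pdivrMr ?exprn_gt0//.
have -> : (1 + e * W) * r m.+1 ^+ 2 * b ^+ 2 =
  r m.+1 ^+ 2 * b ^+ 2 + e * r m.+1 ^+ 2 * (b ^+ 2 * W) by ring.
by rewrite E2 b_sqr; lra.
Qed.

(** The exponents collapse: since [b * (r m - 1) <= r m.+1 - 1], the old exponent
    [2 * b * (r m - 1)] plus the new [2 * (b - 1) * (r m.+1 - 1)] is at most [2 * b * (r m.+1 - 1)].
    The smallness hypothesis keeps the variance below [beta], as the one-step bound requires. *)
Lemma relative_variance_le n : (forall m, (m < n)%N -> r m - 1 <= K) ->
  expR (2 * b * K) * (C3 * beta * n%:R) <= 1 ->
  forall m, (m <= n)%N ->
  v m <= (1 + expR (2 * b * (r m - 1)) * (C3 * beta ^+ 2 * m%:R)) * r m ^+ 2.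
Proof.
have bg := b_gt1; have Cg := C_ge0; have Kg := K_gt1; have sg := sR; have sE := s1E; have bp := b0.
have betag := beta_gt0; have C3g := C3_gt0.
move=> rK small; elim=> [|m IH] mn; first by rewrite v0 r0 mulr0 mulr0 addr0 expr1n mulr1.
have {}IH := IH (ltnW mn); have k0 : 0 <= C3 * beta ^+ 2 by rewrite mulr_ge0 ?sqr_ge0// (ltW C3_gt0).
have [rm g] := mean_growth m; have [rm1 _] := mean_growth m.+1.
have wm : expR (2 * b * (r m - 1)) * (C3 * beta ^+ 2 * m%:R) <= beta.
  rewrite -[leRHS]mulr1 (le_trans _ (ler_wpM2l (ltW beta_gt0) small))//.
  rewrite [leRHS]mulrCA; apply: ler_pM.
  - exact: expR_ge0.
  - by rewrite mulr_ge0 ?ler0n.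
  - by rewrite ler_expR ler_wpM2l ?rK// mulr_ge0// ltW.
  rewrite expr2 !mulrA [beta * C3]mulrC; apply: ler_wpM2l; first by rewrite !mulr_ge0 ?ltW.
  by rewrite ler_nat ltnW.
apply: (le_trans (relative_variance_step _ wm IH)); first by apply: mulr_ge0; [exact: expR_ge0|rewrite mulr_ge0 ?ler0n].
rewrite ler_wpM2r ?sqr_ge0// lerD2l.
have u0 : 0 <= r m - 1 by rewrite subr_ge0.
have gb : b * (r m - 1) <= r m.+1 - 1 by have := divr_ge0 (ltW h_gt0) (ltW b0); lra.
apply: (@le_trans _ _ (expR (2 * (b - 1) * (r m.+1 - 1)) *
  (expR (2 * b * (r m - 1)) * (C3 * beta ^+ 2 * m.+1%:R)))).
  rewrite ler_wpM2l ?expR_ge0// -[m.+1%:R]natr1 [_ * (m%:R + 1)]mulrDr mulr1 [leRHS]mulrDr lerD2l ler_peMl//.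
  by apply: le_trans (expR_ge1Dx _); rewrite lerDl -mulrA mulr_ge0// mulr_ge0// ltW.
rewrite mulrA -expRD; apply: ler_wpM2r; first by rewrite mulr_ge0 ?ler0n.
rewrite ler_expR.
by lra.
Qed.

End fixed_parameters.

Lemma exists_good_level (m0 : R) : 0 < m0 ->
  exists c2 beta0, [/\ 0 < c2, 0 < beta0 &
  forall beta q (r v : nat -> R), 0 < beta -> beta <= beta0 ->
  0 <= q -> q <= 1 + C * beta ^+ 2 ->
  let h := expR (- (c2 / beta)) in
  r 0%N = 1 -> (forall m, r m.+1 = (r m ^+ s * expR h ^+ s.-1 + b - 1) / b) ->
  v 0%N = 1 -> (forall m, 0 <= v m) ->
  (forall m, v m.+1 = (v m ^+ s * (q * expR h ^+ 2) ^+ s.-1 +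
     2 * (b - 1) * (r m ^+ s * expR h ^+ s.-1) + (b - 1) ^+ 2) / b ^+ 2) ->
  exists n, K <= r n /\ (v n / r n ^+ 2 - 1) * (r n / m0) <= 1 / 2].
Proof.
have bg := b_gt1; have Cg := C_ge0; have Kg := K_gt1; have sg := sR; have sE := s1E; have bp := b0.
have C3g := C3_gt0; move=> m0_gt0.
(* Bounds the mean at the first level where it reaches [K]: the preceding mean is below [K], and
   [h <= 1]. *)
pose K' : R := K ^+ s * expR 1 ^+ s.-1 + b.
have K'1 : 1 < K'.
  by rewrite ltr_wpDl// mulr_ge0 ?exprn_ge0 ?expR_ge0//; lra.
pose eps : R := (expR (2 * b * K) * C3)^-1.
have e0 : 0 < eps by rewrite invr_gt0 mulr_gt0 ?expR_gt0.
have lb0 : 0 < ln b by rewrite ln_gt0.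
have b3 : 1 < K * b ^+ 3 by rewrite -[ltLHS]mulr1 ltr_pM// exprn_egt1.
have l3 : 0 < ln (K * b ^+ 3) by rewrite ln_gt0.
(* At the chosen level [n * ln b <= ln (K * b ^ 3) + c2 / beta]. For [beta <= c2 / ln (K * b ^ 3)]
   this gives [n * beta <= eps], which is what the variance bound needs. The other two terms of
   [beta0] serve the one-step bound and the final estimate by 1/2. *)
pose c2 := eps * ln b / 2.
pose beta0 := Num.min (Num.min (2 * (s%:R * (1 + C)))^-1 (c2 / ln (K * b ^+ 3)))
  (m0 / (2 * K' * (expR (2 * b * K') * C3 * eps))).
have c20 : 0 < c2 by rewrite divr_gt0// mulr_gt0.
have sC : 0 < 2 * (s%:R * (1 + C)).
  by rewrite !mulr_gt0//; [exact: lt_trans sR|lra].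
have K'0 : 0 < K' by lra.
have den : 0 < 2 * K' * (expR (2 * b * K') * C3 * eps).
  by rewrite !mulr_gt0// ?expR_gt0.
exists c2, beta0; split => //.
  rewrite /beta0 !lt_min; apply/andP; split; last exact: divr_gt0.
  by apply/andP; split; [rewrite invr_gt0|exact: divr_gt0].
move=> beta q r v beta_gt0; rewrite !le_min => /andP[/andP[beta1 beta2] beta3] q0 qle h r0 rS v0 v_ge0 vS.
have h0 : 0 < h by exact: expR_gt0.
have h1 : h <= 1 by rewrite /h -expR0 ler_expR oppr_le0 divr_ge0 ?ltW.
have bs : 2 * (s%:R * (1 + C)) * beta <= 1.
  by rewrite mulrC -ler_pdivlMr// mul1r.
have grow := mean_growth h0 r0 rS.
have lower := mean_lower_bound h0 r0 rS.
have exn : exists n, K <= r n.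
  have hb : 0 < h / b by rewrite divr_gt0.
  have K0 : 0 < K by exact: lt_trans K_gt1.
  have x0 : 0 <= K / (h / b) / (b - 1) by apply/ltW/divr_gt0; [exact: divr_gt0|rewrite subr_gt0].
  have [N NK] : exists N, K / (h / b) / (b - 1) < N%:R by exists (Num.Def.archi_bound (K / (h / b) / (b - 1))); exact: archi_boundP.
  exists N.+1; have := lower N.
  have bN : N%:R * (b - 1) <= b ^+ N.
    have b10 : 0 <= b - 1 by lra.
    by have := bernoulli_exprn N b10; rewrite subrKC; lra.
  have : K <= N%:R * (b - 1) * (h / b).
    by rewrite -ler_pdivrMr// -ler_pdivrMr ?subr_gt0// ltW.
  have := ler_wpM2r (ltW hb) bN; lra.
have [n rn nmin] := ex_minnP exn.
have below m : (m < n)%N -> r m < K.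
  by move=> mn; rewrite ltNge; apply/negP => /nmin; rewrite leqNgt mn.
have n0 : (0 < n)%N by rewrite lt0n; apply/eqP => n0; move: rn; rewrite n0 r0; lra.
have nb : n%:R * beta <= eps.
  have bn : b ^+ n <= K * b ^+ 3 / h.
    (* [n = 1] is separate: otherwise [mean_lower_bound] is read at the preceding level, where the
       mean is positive-level and still below [K]; the shifts account for [b ^ 3]. *)
    rewrite ler_pdivlMr//; case: n n0 rn {nmin} below => // -[|n] _ _ below.
      rewrite expr1; apply: (@le_trans _ _ b); first by rewrite ler_piMr// ltW.
      have b2 : 1 <= b ^+ 2 by rewrite exprn_ege1// ltW.
      have Kb : 1 * b <= K * b by rewrite ler_pM2r// ltW.
      have Kb0 : 0 <= K * b by rewrite mulr_ge0 ?ltW//; lra.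
      by rewrite exprS mulrA (le_trans (_ : b <= K * b)) ?ler_peMr//; lra.
    have lt := below n.+1 (ltnSn _); have := lower n.
    have -> : b ^+ n.+2 * h = b ^+ n * (h / b) * b ^+ 3.
      by rewrite !exprS; field; rewrite gt_eqF.
    by move=> low; rewrite ler_wpM2r ?exprn_ge0 ?ltW//; lra.
  have : n%:R * ln b <= ln (K * b ^+ 3) + c2 / beta.
    rewrite -[c2 / beta]opprK -(expRK (- (c2 / beta))) -/h -ln_div ?posrE//; last lra.
    rewrite mulr_natl -lnXn// ler_ln ?posrE ?exprn_gt0// divr_gt0//; lra.
  move=> nln; have : n%:R * ln b * beta <= (ln (K * b ^+ 3) + c2 / beta) * beta by rewrite ler_pM2r.
  rewrite mulrDl divfK ?gt_eqF//.
  move: beta2; rewrite ler_pdivlMr// => beta2 nle.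
  rewrite -(ler_pM2r lb0).
  have -> : eps * ln b = 2 * c2 by rewrite /c2; field.
  by lra.
have smallK : expR (2 * b * K) * (C3 * beta * n%:R) <= 1.
  have eC : 0 < expR (2 * b * K) * C3 by rewrite mulr_gt0 ?expR_gt0.
  have -> : expR (2 * b * K) * (C3 * beta * n%:R) =
    expR (2 * b * K) * C3 * (n%:R * beta) by ring.
  by rewrite (le_trans (ler_wpM2l (ltW eC) nb))// /eps divff// gt_eqF.
have rK m : (m < n)%N -> r m - 1 <= K by move=> /below; lra.
have vle := relative_variance_le beta_gt0 bs h0 q0 qle r0 rS v0 v_ge0 vS rK smallK (leqnn n).
have rK' : r n <= K'.
  have [n' ne] : exists n', n = n'.+1 by exists n.-1; rewrite prednK.
  rewrite ne rS ler_pdivrMr//.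
  have [r1 _] := grow n'.
  have X1 : r n' ^+ s * expR h ^+ s.-1 <= K ^+ s * expR 1 ^+ s.-1.
    have rk : r n' <= K by rewrite ltW// below// ne.
    have r0' : 0 <= r n' by lra.
    apply: ler_pM; rewrite ?exprn_ge0 ?expR_ge0// lerXn2r ?nnegrE ?expR_ge0//; last by rewrite ler_expR.
    lra.
  have Z0 : 0 <= K ^+ s * expR 1 ^+ s.-1 by rewrite mulr_ge0 ?exprn_ge0 ?expR_ge0//; lra.
  by rewrite /K'; nra.
have [rn1 _] := grow n; exists n; split => //.
have rn0 : 0 < r n by lra.
have W : v n / r n ^+ 2 - 1 <= expR (2 * b * K') * (C3 * eps * beta).
  rewrite lerBlDl ler_pdivrMr ?exprn_gt0//; apply: (le_trans vle).
  rewrite ler_pM2r ?exprn_gt0// lerD2l; apply: ler_pM.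
  - exact: expR_ge0.
  - by rewrite !mulr_ge0 ?ler0n ?ltW.
  - by rewrite ler_expR ler_wpM2l ?mulr_ge0 ?ltW//; lra.
  rewrite expr2 -!mulrA ler_pM2l// [X in _ <= X]mulrC ler_pM2l//.
  by rewrite mulrC.
have rm0 : 0 < r n / m0 by rewrite divr_gt0.
apply: (le_trans (ler_wpM2r (ltW rm0) W)).
apply: (@le_trans _ _ (expR (2 * b * K') * (C3 * eps * beta) * (K' / m0))).
  apply: ler_wpM2l; last by rewrite ler_pM2r ?invr_gt0.
  by rewrite !mulr_ge0 ?expR_ge0 ?(ltW C3g) ?(ltW e0) ?(ltW beta_gt0).
rewrite ler_pdivlMr// in beta3; rewrite mulrA ler_pdivrMr//.
have gen (e x y z t : R) : e * (z * y * t) * x = 1 / 2 * (t * (2 * x * (e * z * y))).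
  by field.
by rewrite gen ler_pM2l.
Qed.

End second_moment_growth.

(** * The law of one site *)

Section site_law.
Context d (T : measurableType d) (R : realType) (P : probability T R).
Variable X : T -> R.
Hypotheses (mX : measurable_fun setT X)
  (X_mean : (\int[P]_x (X x)%:E = 0)%E)
  (X_var : (\int[P]_x ((X x) ^+ 2)%:E = 1)%E)
  (X_exp : forall beta : R, 0 < beta ->
     P.-integrable setT (fun x => (expR (beta * X x))%:E)).

Definition mgf (beta : R) : R := fine (\int[P]_x (expR (beta * X x))%:E).

Lemma has_expect_mgf beta : 0 < beta ->
  has_expect P (fun x => expR (beta * X x)) (mgf beta).
Proof. by move=> b0; exact: (integrable_has_expect (X_exp b0)). Qed.

Lemma has_expect_sqr : has_expect P (fun x => X x ^+ 2) 1.
Proof.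
apply: ge0_has_expect => //; first exact: measurable_funX.
by move=> a; exact: sqr_ge0.
Qed.

(** Integrability comes from [|X| <= 1 + X ^ 2]. *)
Lemma has_expect_mean : has_expect P X 0.
Proof.
split => //.
have [i _] := has_expectD (has_expect_cst P 1) has_expect_sqr.
apply: le_integrable i => //; first exact/measurable_EFinP.
move=> x _; rewrite /= lee_fin [leRHS]ger0_norm ?addr_ge0 ?sqr_ge0//.
rewrite ler_norml; have := sqr_ge0 (X x - 1); have := sqr_ge0 (X x + 1).
by rewrite !expr2 => ? ?; apply/andP; split; nra.
Qed.

Lemma mgf_ge1 beta : 0 < beta -> 1 <= mgf beta.
Proof.
move=> b0; have := has_expectD (has_expect_cst P 1) (has_expectZ beta has_expect_mean).
rewrite mulr0 addr0 => h; apply: (has_expect_le _ h (has_expect_mgf b0)) => x.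
exact: expR_ge1Dx.
Qed.

Lemma mgf_le beta : 0 < beta -> beta <= 1 -> mgf beta <= 1 + mgf 1.
Proof.
move=> b0 b1; apply: (has_expect_le _ (has_expect_mgf b0)
  (has_expectD (has_expect_cst P 1) (has_expect_mgf ltr01))) => x.
rewrite mul1r; have [x0|x0] := leP (X x) 0.
  rewrite (@le_trans _ _ 1)// ?lerDl ?expR_ge0// expR_le1.
  by rewrite mulr_ge0_le0// ltW.
rewrite (@le_trans _ _ (expR (X x)))// ?lerDr// ler_expR.
by rewrite ler_piMl// ltW.
Qed.

(** Pointwise bound, with [y = 2 * beta * X]. For [y <= 1/2] the quadratic estimate applies.
    Otherwise [1 <= 4 * y ^ 2], [y <= X / 2] and [X ^ 2 <= 8 * expR (X / 2)] give
    [expR y <= 128 * beta ^ 2 * expR X]. The linear term has mean 0. *)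
Lemma mgf_le_quad beta : 0 < beta -> beta <= 1 / 4 ->
  mgf (2 * beta) <= 1 + (8 + 128 * mgf 1) * beta ^+ 2.
Proof.
move=> b0 b4; have b20 : 0 < 2 * beta by rewrite mulr_gt0.
have := has_expectD (has_expectD (has_expect_cst P 1) (has_expectZ (2 * beta) has_expect_mean))
  (has_expectD (has_expectZ (8 * beta ^+ 2) has_expect_sqr)
     (has_expectZ (128 * beta ^+ 2) (has_expect_mgf ltr01))).
rewrite (_ : _ + _ = 1 + (8 + 128 * mgf 1) * beta ^+ 2 :> R); last by ring.
move=> h; apply: (has_expect_le _ (has_expect_mgf b20) h) => x.
rewrite mul1r; set y := 2 * beta * X x.
have bb : 0 <= beta ^+ 2 by exact: sqr_ge0.
have e0 := expR_ge0 (X x).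
have [y2|y2] := leP y (1 / 2).
  apply: (le_trans (expR_le_quad y2)).
  have -> : 2 * y ^+ 2 = 8 * beta ^+ 2 * X x ^+ 2 by rewrite /y; ring.
  by rewrite lerD2l lerDl mulr_ge0// mulr_ge0.
have x0 : 0 < X x by rewrite -(pmulr_rgt0 _ b20) -/y; lra.
have x8 : X x ^+ 2 <= 8 * expR (X x / 2).
  have := @expR_ge1Dxn R (X x / 2) 1 (divr_ge0 (ltW x0) (ler0n _ 2)).
  by rewrite (_ : 2`!%:R = 2 :> R)// !expr2 => ?; lra.
have y4 : 1 <= 4 * y ^+ 2.
  by rewrite expr2; nra.
have ey : expR y <= 128 * beta ^+ 2 * expR (X x).
  have y1 : expR y <= expR (X x / 2).
    by rewrite ler_expR /y [leRHS]mulrC ler_pM2r//; lra.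
  apply: (@le_trans _ _ (4 * y ^+ 2 * expR (X x / 2))).
    by rewrite (le_trans y1)// ler_peMl// expR_ge0.
  have -> : expR (X x) = expR (X x / 2) * expR (X x / 2).
    by rewrite -expRD -splitr.
  have -> : 4 * y ^+ 2 = 16 * beta ^+ 2 * X x ^+ 2 by rewrite /y; ring.
  have := ler_wpM2l (mulr_ge0 (mulr_ge0 (ler0n R 16) bb) (expR_ge0 (X x / 2))) x8.
  by lra.
have : 0 <= 8 * beta ^+ 2 * X x ^+ 2 by apply: mulr_ge0 (sqr_ge0 _); exact: mulr_ge0.
by lra.
Qed.

Definition pos_ind (t : R) : R := if 0 < t then 1 else 0.
Definition pos_prob : R := fine (\int[P]_x (pos_ind (X x))%:E).
Definition pos_mean : R := fine (\int[P]_x (Num.max (X x) 0)%:E).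
Definition psi (t : R) : R := pos_ind t - pos_prob.

Lemma measurable_pos_ind : measurable_fun setT pos_ind.
Proof.
by apply: measurable_fun_ifT => //; apply: measurable_fun_ltr.
Qed.

Lemma pos_ind_ge0 t : 0 <= pos_ind t. Proof. by rewrite /pos_ind; case: ifP. Qed.
Lemma pos_ind_le1 t : pos_ind t <= 1. Proof. by rewrite /pos_ind; case: ifP. Qed.

Lemma has_expect_pos_ind : has_expect P (fun x => pos_ind (X x)) pos_prob.
Proof.
have mp : measurable_fun setT (fun x => pos_ind (X x)).
  exact: measurableT_comp measurable_pos_ind mX.
apply: integrable_has_expect; have [i _] := has_expect_cst P 1.
apply: le_integrable i => //; first exact/measurable_EFinP.
by move=> x _; rewrite /= lee_fin normr1 ger0_norm ?pos_ind_le1 ?pos_ind_ge0.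
Qed.

Lemma has_expect_pos : has_expect P (fun x => Num.max (X x) 0) pos_mean.
Proof.
apply: integrable_has_expect; have [i _] := has_expect_mean.
apply: le_integrable i => //.
  by apply/measurable_EFinP; exact: measurable_maxr.
move=> x _; rewrite /= lee_fin; have [x0|x0] := leP (X x) 0.
  by rewrite normr0.
by [].
Qed.

Lemma expect_eq0 (f g : T -> R) y : has_expect P f 0 -> has_expect P g y ->
  (forall x, 0 <= f x) -> (forall x, f x = 0 -> g x = 0) -> y = 0.
Proof.
move=> [fi f0] [gi gy] fge fg; have /integrableP[mf _] := fi.
have /integrableP[mg _] := gi.
have ae : ae_eq P setT (EFin \o f) (cst 0%E).
  apply/(ae_eq_integral_abs P measurableT mf).
  under eq_integral do rewrite /= ger0_norm//.
  exact: f0.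
have : (\int[P]_x (g x)%:E = \int[P]_x cst 0%E x)%E.
  apply: ae_eq_integral => //.
  by apply: filterS ae => x /= fx _; have [/fg ->] := fx I.
by rewrite gy integral0 => -[].
Qed.

Lemma pos_prob_bounds : 0 <= pos_prob <= 1.
Proof.
apply/andP; split.
  exact: (has_expect_le (fun x => pos_ind_ge0 (X x)) (has_expect_cst P 0) has_expect_pos_ind).
exact: (has_expect_le (fun x => pos_ind_le1 (X x)) has_expect_pos_ind (has_expect_cst P 1)).
Qed.

Lemma psi_bound t : -1 <= psi t <= 1.
Proof.
have /andP[p0 p1] := pos_prob_bounds.
have := pos_ind_ge0 t; have := pos_ind_le1 t; rewrite /psi => ? ?.
by apply/andP; split; lra.
Qed.

(** If the positive part had mean 0, so would [|X| = 2 * max X 0 - X]; then [X ^ 2] would vanish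
    almost everywhere, against variance 1. *)
Lemma pos_mean_gt0 : 0 < pos_mean.
Proof.
have pge0 : 0 <= pos_mean.
  apply: (has_expect_le _ (has_expect_cst P 0) has_expect_pos) => x.
  by rewrite le_max lexx orbT.
rewrite lt_neqAle pge0 andbT eq_sym; apply/eqP => p0.
have := has_expectD (has_expectZ 2 has_expect_pos) (has_expectZ (-1) has_expect_mean).
rewrite p0 !mulr0 addr0 => h.
have := expect_eq0 h has_expect_sqr; move=> e.
have : (1 : R) = 0; last by move/eqP; rewrite oner_eq0.
apply: e => x; have [x0|x0] := leP (X x) 0; rewrite ?expr2; nra.
Qed.

(** If [X > 0] almost surely, then [max X 0 - X] vanishes almost surely, so the positive part would
    have mean 0. *)
Lemma pos_prob_lt1 : pos_prob < 1.
Proof.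
have /andP[p0 p1] := pos_prob_bounds.
rewrite lt_neqAle p1 andbT; apply/eqP => pE.
have h := has_expectD (has_expect_cst P 1) (has_expectZ (-1) has_expect_pos_ind).
have h' := has_expectD has_expect_pos (has_expectZ (-1) has_expect_mean).
rewrite pE mulN1r subrr in h; rewrite mulr0 addr0 in h'.
have := pos_mean_gt0; rewrite (expect_eq0 h h') ?ltxx//.
  by move=> x; rewrite mulN1r subr_ge0 pos_ind_le1.
move=> x; rewrite /pos_ind; case: ifPn => [x0 _|_].
  by rewrite max_l ?ltW// mulN1r subrr.
by rewrite mulr0 addr0 => /eqP; rewrite oner_eq0.
Qed.

Lemma measurable_psi : measurable_fun setT psi.
Proof.
by apply: measurable_funB; [exact: measurable_pos_ind|exact: measurable_cst].
Qed.

Lemma has_expect_psi : has_expect P (fun x => psi (X x)) 0.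
Proof.
have := has_expectD has_expect_pos_ind (has_expect_cst P (- pos_prob)).
by rewrite subrr.
Qed.

Definition tilt_gain : R := (1 - pos_prob) * pos_mean.

Lemma tilt_gain_gt0 : 0 < tilt_gain.
Proof. by rewrite mulr_gt0 ?pos_mean_gt0// subr_gt0 pos_prob_lt1. Qed.

(** Integrates [psi X * expR (beta * X) >= psi X + (1 - pos_prob) * beta * max X 0]. For positive
    [X] this is [expR y >= 1 + y]; elsewhere [psi] is nonpositive and the exponential at most 1. *)
Lemma has_expect_psi_exp beta : 0 < beta ->
  exists2 J, has_expect P (fun x => psi (X x) * expR (beta * X x)) J &
    tilt_gain * beta <= J.
Proof.
move=> b0; have [ie _] := has_expect_mgf b0.
have mpsi : measurable_fun setT (fun x => psi (X x)).
  exact: measurableT_comp measurable_psi mX.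
have /integrableP[/measurable_EFinP me _] := ie.
have i : P.-integrable setT (EFin \o (fun x => psi (X x) * expR (beta * X x))).
  apply: le_integrable ie => //.
    by apply/measurable_EFinP; exact: measurable_funM.
  move=> x _; rewrite /= lee_fin normrM ler_piMl// ler_norml.
  exact: psi_bound.
exists (fine (\int[P]_x (psi (X x) * expR (beta * X x))%:E)).
  exact: integrable_has_expect.
have := has_expectD has_expect_psi (has_expectZ ((1 - pos_prob) * beta) has_expect_pos).
rewrite add0r mulrAC => h.
apply: (has_expect_le _ h (integrable_has_expect i)) => x.
have /andP[p0 p1] := pos_prob_bounds.
have e1 := expR_ge1Dx (beta * X x).
rewrite /psi /pos_ind; case: ifPn => [x0|].
  rewrite (max_l (ltW x0)).
  have : 0 <= (1 - pos_prob) * (expR (beta * X x) - (1 + beta * X x)).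
    by rewrite mulr_ge0// subr_ge0.
  by lra.
rewrite -leNgt => x0; rewrite max_r// mulr0 addr0.
have : expR (beta * X x) <= 1 by rewrite expR_le1 mulr_ge0_le0// ltW.
by nra.
Qed.

(** * The pinning factor of one site and its tilted mean *)

Section site_weight.
Variables (beta h : R).
Hypothesis beta_gt0 : 0 < beta.

Definition site_factor (t : R) : R := expR (beta * t - ln (mgf beta) + h).

Let M_gt0 : 0 < mgf beta. Proof. exact: lt_le_trans ltr01 (mgf_ge1 beta_gt0). Qed.

Lemma site_factorE t : site_factor t = expR h / mgf beta * expR (beta * t).
Proof.
by rewrite /site_factor expRD expRB lnK ?posrE//; field; rewrite gt_eqF.
Qed.

Lemma measurable_site_factor : measurable_fun setT site_factor.
Proof.
apply: measurableT_comp => //; apply: measurable_funD => //.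
by apply: measurable_funB => //; exact: measurable_funM.
Qed.

Lemma has_expect_site_factor : has_expect P (fun x => site_factor (X x)) (expR h).
Proof.
have := has_expectZ (expR h / mgf beta) (has_expect_mgf beta_gt0).
rewrite divfK ?gt_eqF//; under eq_fun do rewrite -site_factorE.
by [].
Qed.

Lemma has_expect_site_factor_sqr : has_expect P (fun x => site_factor (X x) ^+ 2)
  (mgf (2 * beta) / mgf beta ^+ 2 * expR h ^+ 2).
Proof.
have b20 : 0 < 2 * beta by rewrite mulr_gt0.
have := has_expectZ ((expR h / mgf beta) ^+ 2) (has_expect_mgf b20).
rewrite (_ : _ * mgf (2 * beta) = mgf (2 * beta) / mgf beta ^+ 2 * expR h ^+ 2); last first.
  by field; rewrite gt_eqF.
apply: eq_has_expect => x.
rewrite site_factorE [RHS]exprMn; congr (_ * _).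
by rewrite -mulrA expRM_natl.
Qed.

Lemma has_expect_ln_site_factor : has_expect P (fun x => ln (site_factor (X x))) (h - ln (mgf beta)).
Proof.
have := has_expectD (has_expectZ beta has_expect_mean) (has_expect_cst P (h - ln (mgf beta))).
rewrite mulr0 add0r; apply: eq_has_expect => x.
by rewrite /site_factor expRK; ring.
Qed.

Lemma has_expect_tilted_weight delta :
  has_expect P (fun x => 1 - delta * psi (X x)) 1.
Proof.
have := has_expectD (has_expect_cst P 1) (has_expectZ (- delta) has_expect_psi).
rewrite mulr0 addr0; under eq_fun do rewrite mulNr.
by [].
Qed.

(** The gain is linear in [delta * beta]; bounding [mgf beta] by [1 + mgf 1] frees its constant from
    [beta]. *)
Lemma has_expect_site_factor_tilted delta : 0 <= delta -> beta <= 1 ->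
  exists2 y, has_expect P (fun x => site_factor (X x) * (1 - delta * psi (X x))) y &
    y <= expR (h - delta * (tilt_gain / (1 + mgf 1)) * beta).
Proof.
move=> d0 b1; have [J hJ Jge] := has_expect_psi_exp beta_gt0.
have := has_expectD has_expect_site_factor (has_expectZ (- delta * (expR h / mgf beta)) hJ).
set y := (X in has_expect _ _ X) => hy; exists y.
  by apply: eq_has_expect hy => x; rewrite site_factorE; ring.
have M1 := mgf_le beta_gt0 b1; have M0 := M_gt0.
have key : tilt_gain / (1 + mgf 1) * beta <= J / mgf beta.
  rewrite mulrAC (le_trans (_ : _ <= tilt_gain * beta / mgf beta))//.
    apply: ler_wpM2l; first by rewrite mulr_ge0 ?ltW ?tilt_gain_gt0.
    by rewrite lef_pV2 ?posrE// (lt_le_trans M0).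
  by rewrite ler_pM2r ?invr_gt0.
rewrite /y expRD (le_trans (_ : _ <= expR h * (1 - delta * (J / mgf beta))))//.
  by rewrite le_eqVlt; apply/orP; left; apply/eqP; field; rewrite gt_eqF.
rewrite ler_pM2l ?expR_gt0//; apply: le_trans (expR_ge1Dx _).
by rewrite lerD2l lerN2 -mulrA ler_wpM2l.
Qed.

End site_weight.

(** The expansion of the inverse power has first-order term [k * delta * psi], of mean 0, so the
    cost of the tilt is only quadratic in [delta]. *)
Lemma expect_inv_weight delta k : (0 < k)%N -> 0 <= delta -> 4 * k%:R * delta <= 1 ->
  exists2 z, has_expect P (fun x => (1 - delta * psi (X x))^-1 ^+ k) z &
    0 <= z <= expR ((2 * k%:R + 8 * k%:R ^+ 2) * delta ^+ 2).
Proof.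
move=> k0 d0 dk; have k1 : 1 <= k%:R :> R by rewrite ler1n.
have d4 : delta <= 1 / 4.
  have : 1 * delta <= k%:R * delta by rewrite ler_wpM2r.
  by lra.
have yb x : `|delta * psi (X x)| <= delta.
  by rewrite normrM ger0_norm// ler_piMr// ler_norml psi_bound.
have w0 x : 0 < 1 - delta * psi (X x).
  by have := yb x; rewrite ler_norml => /andP[]; lra.
have mw : measurable_fun setT (fun x => (1 - delta * psi (X x))^-1 ^+ k).
  have -> : (fun x => (1 - delta * psi (X x))^-1 ^+ k) =
      (fun x => (1 - delta * psi (X x)) `^ (- 1) ^+ k).
    by apply/funext => x; rewrite powR_inv1// ltW.
  apply: measurable_funX; apply: (measurableT_comp (measurable_powR (-1))).
  apply: measurable_funB => //; apply: measurable_funM => //.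
  exact: measurableT_comp measurable_psi mX.
have ge0 x : 0 <= (1 - delta * psi (X x))^-1 ^+ k by rewrite exprn_ge0// invr_ge0 ltW.
pose C := (2 * k%:R + 8 * k%:R ^+ 2) * delta ^+ 2.
have hb : has_expect P (fun x => 1 + C + k%:R * delta * psi (X x)) (1 + C).
  have := has_expectD (has_expect_cst P (1 + C)) (has_expectZ (k%:R * delta) has_expect_psi).
  by rewrite mulr0 addr0.
have C0 : 0 <= C by rewrite mulr_ge0 ?sqr_ge0// addr_ge0 ?mulr_ge0 ?sqr_ge0//; lra.
have pt x : (1 - delta * psi (X x))^-1 ^+ k <= 1 + C + k%:R * delta * psi (X x).
  set y := delta * psi (X x); have := yb x; rewrite -/y => yd.
  have := yd; rewrite ler_norml => /andP[y1 y2].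
  have y0 : 0 < 1 - y by exact: w0.
  have inv : (1 - y)^-1 <= expR (y + 2 * y ^+ 2).
    apply: le_trans (expR_ge1Dx _); rewrite -[_^-1]mul1r ler_pdivrMr//.
    have : 0 <= y ^+ 2 * (1 - 2 * y) by rewrite mulr_ge0 ?sqr_ge0//; lra.
    by rewrite !expr2; nra.
  have ypow : (1 - y)^-1 ^+ k <= expR (k%:R * (y + 2 * y ^+ 2)).
    by rewrite expRM_natl lerXn2r ?nnegrE ?expR_ge0// invr_ge0 ltW.
  apply: (le_trans ypow).
  have ysq : y ^+ 2 <= delta ^+ 2.
    by rewrite -real_normK ?num_real// lerXn2r ?nnegrE.
  have dsq : delta ^+ 2 <= delta / 4 by rewrite expr2 ler_wpM2l//; lra.
  set z := k%:R * _.
  have zle : `|z| <= 2 * k%:R * delta.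
    rewrite /z normrM ger0_norm; last lra.
    have y2d : `|y + 2 * y ^+ 2| <= 2 * delta.
      by rewrite ler_norml; have := sqr_ge0 y => ?; apply/andP; split; lra.
    by have := ler_wpM2l (ler0n R k) y2d; lra.
  have z2 : z <= 1 / 2 by have := ler_norm z; lra.
  apply: (le_trans (expR_le_quad z2)).
  have zsq : z ^+ 2 <= (2 * k%:R * delta) ^+ 2.
    rewrite -real_normK ?num_real// lerXn2r ?nnegrE//.
    by rewrite !mulr_ge0//; lra.
  have : k%:R * (2 * y ^+ 2) <= k%:R * (2 * delta ^+ 2).
    by rewrite ler_wpM2l//; lra.
  have -> : 1 + C + k%:R * delta * psi (X x) = 1 + k%:R * y +
    k%:R * (2 * delta ^+ 2) + 2 * (2 * k%:R * delta) ^+ 2 by rewrite /C /y; ring.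
  have -> : 1 + z = 1 + k%:R * y + k%:R * (2 * y ^+ 2) by rewrite /z; ring.
  by lra.
have le := expect_le P mw _ ge0 pt.
have [|z Ez /andP[z0 z1]] := @expect_le_fine _ _ _ P _ (1 + C) ge0.
  have [_ <-] := hb; apply: le; have [/integrableP[/measurable_EFinP]] := hb.
  by [].
exists z; first exact: ge0_has_expect.
by rewrite z0 (le_trans z1)// expR_ge1Dx.
Qed.

End site_law.

(** * Bounds on the critical point *)

Section pinning_model.
Variables (s : nat) (d : measure_display) (T : measurableType d) (R : realType)
  (P : probability T R) (om : nat -> {RV P >-> R}).
Hypotheses (s_ge2 : (2 <= s)%N)
  (Hind : mutually_independent om) (Hid : identically_distributed om)
  (Hmean : (\int[P]_x (om 0%N x)%:E = 0)%E)
  (Hvar : (\int[P]_x ((om 0%N x) ^+ 2)%:E = 1)%E)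
  (Hexp : forall beta : R, 0 < beta ->
     P.-integrable setT (fun x => (expR (beta * om 0%N x))%:E)).

Let b : R := Num.sqrt s%:R.
Let X : T -> R := om 0%N.
Let nu := envlaw om.
Let mX : measurable_fun setT X. Proof. exact: measurable_funPT. Qed.
Let s_gt0 : (0 < s)%N. Proof. exact: leq_trans s_ge2. Qed.
Let b_sqr : b ^+ 2 = s%:R. Proof. by rewrite sqr_sqrtr// ler0n. Qed.
Let b_gt1 : 1 < b.
Proof. by rewrite -[ltLHS]sqrtr1 ltr_sqrt ?ltr1n// ltr0n. Qed.
Let b_gt0 : 0 < b. Proof. exact: lt_trans b_gt1. Qed.
Let mu (B : set R) : \bar R := P (om 0%N @^-1` B).
Let nu_cylinder n (B : nat -> set R) : (forall i, measurable (B i)) ->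
  nu (cylinder n B) = (\prod_(i < n) mu (B i))%E.
Proof. exact: envlaw_cylinder. Qed.
Local Notation M := (mgf P X).
Local Notation psi := (psi P X).
Local Notation A := (site_factor P X).
Local Notation E f := (\int[nu]_a (f a)%:E)%E.

Lemma integral_env (f : seqT R -> R) : measurable_fun setT f ->
  (\int[P]_x (f (env om x))%:E = E f)%E.
Proof.
move=> mf; apply: integral_law => // g mg g0.
rewrite ge0_integral_envlaw//; exact/measurable_EFinP.
Qed.

Lemma has_expect_env (f : seqT R -> R) y : measurable_fun setT f ->
  has_expect P (fun x => f (env om x)) y -> has_expect nu f y.
Proof.
move=> mf [fi fy]; split; last by rewrite -integral_env.
apply/integrableP; split; first exact/measurable_EFinP.
rewrite (_ : (\int[nu]_a _)%E = E (fun a => `|f a|))//.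
rewrite -integral_env; last exact: measurableT_comp.
by move/integrableP : fi => [_].
Qed.

Lemma has_expect_site (w : R -> R) y : measurable_fun setT w ->
  has_expect P (fun x => w (X x)) y -> has_expect nu (fun a => w (a 0%N)) y.
Proof.
move=> mw h; apply: has_expect_env => //.
exact: measurableT_comp mw (measurable_coord _).
Qed.

Lemma A_gt0 beta h t : 0 < A beta h t. Proof. exact: expR_gt0. Qed.

Let mA beta h := measurable_site_factor P X beta h.

Lemma ElogR_mean_log beta h n : ElogR om s b beta h n = mean_log s b (A beta h) nu n.
Proof.
rewrite /ElogR /mean_log; congr fine.
rewrite -(integral_env (f := fun a => ln (Rn s b (A beta h) n a)))//.
apply: measurableT_comp; first exact: measurable_ln.
exact: measurable_Rn.
Qed.

Lemma free_energyE beta h : free_energy om s b beta h =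
  limn (fun n => mean_log s b (A beta h) nu n / (s ^ n)%:R).
Proof.
by rewrite /free_energy; congr (limn _); apply/funext => n; rewrite ElogR_mean_log.
Qed.

(** * Moments and positivity of the free energy at fixed parameters *)

Section fixed_disorder.
Variables beta h : R.
Hypothesis beta_gt0 : 0 < beta.
Local Notation Rn := (Rn s b (A beta h)).

Definition rmean n : R := fine (E (Rn n)).

Let A_ge0 t : 0 <= A beta h t. Proof. exact/ltW/A_gt0. Qed.

Lemma site_mean : has_expect nu (fun a => A beta h (a 0%N)) (expR h).
Proof.
exact: has_expect_site (mA beta h) (has_expect_site_factor mX Hmean Hvar Hexp h beta_gt0).
Qed.

Lemma rmean_rec n : E (Rn n) = (rmean n)%:E /\
  rmean n.+1 = (rmean n ^+ s * expR h ^+ s.-1 + b - 1) / b.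
Proof.
have step m : E (Rn m) = (rmean m)%:E ->
    E (Rn m.+1) = ((rmean m ^+ s * expR h ^+ s.-1 + b - 1) / b)%:E.
  move=> Em; have [_ EA] := site_mean.
  exact: (expect_Rn s_gt0 b_gt1 (mA beta h) A_ge0 nu_cylinder Em EA).
suff Em m : E (Rn m) = (rmean m)%:E by split => //; rewrite {1}/rmean step.
elim: m => [|m IH]; last by rewrite /rmean step.
by rewrite /rmean (expect_cst nu 1).
Qed.

Lemma rmean0 : rmean 0 = 1.
Proof. by rewrite /rmean (expect_cst nu 1). Qed.

Lemma rmean_ge0 n : 0 <= rmean n.
Proof.
rewrite -lee_fin -(rmean_rec n).1; apply: integral_ge0 => a _; rewrite lee_fin.
by apply/ltW/Rn_gt0.
Qed.

(** The bound is the annealed weight of touching all [s ^ n - 1] sites; being at least 1, it also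
    dominates the constant [b - 1] in the recursion. *)
Lemma rmean_le n : 0 <= h -> rmean n <= expR (h * (s ^ n)%:R - h).
Proof.
move=> h0; elim: n => [|n IH]; first by rewrite rmean0 expn0 mulr1 subrr expR0.
rewrite (rmean_rec n).2 ler_pdivrMr//.
set Y := expR (h * (s ^ n.+1)%:R - h).
have Y1 : 1 <= Y.
  apply: le_trans (expR_ge1Dx _); rewrite lerDl subr_ge0 ler_peMr//.
  by rewrite ler1n expn_gt0 s_gt0.
have XY : rmean n ^+ s * expR h ^+ s.-1 <= Y.
  apply: (@le_trans _ _ (expR (h * (s ^ n)%:R - h) ^+ s * expR h ^+ s.-1)).
    by rewrite ler_wpM2r ?exprn_ge0 ?expR_ge0// lerXn2r ?nnegrE ?rmean_ge0 ?expR_ge0.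
  rewrite -!expRM_natl -expRD ler_expR expnS natrM.
  have -> : s%:R = s.-1%:R + 1 :> R by rewrite natr1 prednK.
  by rewrite le_eqVlt; apply/orP; left; apply/eqP; ring.
by have := b_gt1; nra.
Qed.

Definition vmean n : R := fine (E (fun a => Rn n a ^+ 2)).

Lemma vmean_rec n : E (fun a => Rn n a ^+ 2) = (vmean n)%:E /\
  vmean n.+1 = (vmean n ^+ s * (M (2 * beta) / M beta ^+ 2 * expR h ^+ 2) ^+ s.-1 +
     2 * (b - 1) * (rmean n ^+ s * expR h ^+ s.-1) + (b - 1) ^+ 2) / b ^+ 2.
Proof.
have mA2 : measurable_fun setT (fun t => A beta h t ^+ 2).
  by apply: measurable_funX; exact: mA.
have [_ EA2] := has_expect_site mA2
  (has_expect_site_factor_sqr mX Hmean Hvar Hexp h beta_gt0).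
have step m : E (fun a => Rn m a ^+ 2) = (vmean m)%:E ->
    E (fun a => Rn m.+1 a ^+ 2) =
  ((vmean m ^+ s * (M (2 * beta) / M beta ^+ 2 * expR h ^+ 2) ^+ s.-1 +
     2 * (b - 1) * (rmean m ^+ s * expR h ^+ s.-1) + (b - 1) ^+ 2) / b ^+ 2)%:E.
  move=> Em; have [_ EA] := site_mean.
  exact: (expect_Rn_sqr s_gt0 b_gt1 (mA beta h) A_ge0 nu_cylinder
    (rmean_rec m).1 EA Em EA2).
suff Em m : E (fun a => Rn m a ^+ 2) = (vmean m)%:E by split => //; rewrite {1}/vmean step.
elim: m => [|m IH]; last by rewrite /vmean step.
by rewrite /vmean; under eq_integral do rewrite expr1n; rewrite (expect_cst nu 1).
Qed.

Lemma vmean_ge0 n : 0 <= vmean n.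
Proof.
rewrite -lee_fin -(vmean_rec n).1; apply: integral_ge0 => a _.
by rewrite lee_fin sqr_ge0.
Qed.

Lemma vmean0 : vmean 0 = 1.
Proof. by rewrite /vmean; under eq_integral do rewrite expr1n; rewrite (expect_cst nu 1). Qed.

(** Superadditivity with [c = h - ln M - ln b / (s - 1)], which spreads the loss [ln b] over the
    [s - 1] extra sites; the hypothesis says [mean_log + c > 0] at one level. *)
Lemma free_energy_gt0 n : 0 <= h ->
  ln b / s.-1%:R + ln (M beta) - h < mean_log s b (A beta h) nu n ->
  0 < free_energy om s b beta h.
Proof.
move=> h0 lt; rewrite free_energyE.
have s1 : 0 < s.-1%:R :> R by rewrite ltr0n -subn1 subn_gt0.
apply: (@lim_superadditive_gt0 _ _ s_ge2 _ (h - ln (M beta) - ln b / s.-1%:R) h n).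
- move=> m.
  have mlnA : measurable_fun setT (fun t => ln (A beta h t)).
    by apply: measurableT_comp; [exact: measurable_ln|exact: mA].
  have he := has_expect_site mlnA (has_expect_ln_site_factor mX Hmean Hvar beta h).
  have := mean_log_superadditive b_gt1 (mA beta h) (A_gt0 beta h) nu_cylinder
    (rmean_rec m).1 (rmean_rec m.+1).1 he.
  have -> : s.-1%:R * (h - ln (M beta) - ln b / s.-1%:R) =
    s.-1%:R * (h - ln (M beta)) - ln b by field; rewrite gt_eqF.
  by rewrite addrA.
- move=> m; have r0 : 0 < rmean m.
    have := mean_log_ge b_gt1 (mA beta h) (A_gt0 beta h) (rmean_rec m).1.
    move=> _; case: m => [|m]; first by rewrite rmean0.
    rewrite (rmean_rec m).2 divr_gt0// -addrA ltr_wpDl ?subr_gt0//.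
    by rewrite mulr_ge0 ?exprn_ge0 ?rmean_ge0 ?expR_ge0.
  apply: (le_trans (mean_log_le b_gt1 (mA beta h) (A_gt0 beta h) r0 (rmean_rec m).1)).
  rewrite -[leRHS]expRK ler_ln ?posrE ?expR_gt0// (le_trans (rmean_le m h0))//.
  by rewrite ler_expR lerBlDr lerDl.
- by lra.
Qed.

End fixed_disorder.

Lemma variance_ratio_le (x y C beta : R) : 1 <= x -> 1 <= y ->
  x <= 1 + C * beta ^+ 2 -> 0 <= x / y ^+ 2 <= 1 + C * beta ^+ 2.
Proof.
move=> x1 y1 xC; have x0 : 0 <= x by exact: le_trans x1.
have y2 : 1 <= y ^+ 2 by rewrite exprn_ege1.
rewrite divr_ge0 ?sqr_ge0//=; apply: le_trans xC.
by rewrite ler_pdivrMr ?(lt_le_trans ltr01 y2)// ler_peMr.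
Qed.

Lemma ln_mgf_le1 (C beta : R) : 8 <= C -> 0 < beta -> beta <= C^-1 ->
  M (2 * (beta / 2)) <= 1 + C * (beta / 2) ^+ 2 -> ln (M beta) <= 1.
Proof.
move=> C8 b0 bC; have C0 : 0 < C by exact: lt_le_trans C8.
rewrite [2 * _]mulrC divfK// => Mle.
have Cb : C * beta <= 1 by rewrite mulrC -ler_pdivlMr// mul1r.
have b1 : beta <= 1.
  by apply: le_trans bC _; rewrite invf_le1// (le_trans _ C8)// ler1n.
have Cb2 : C * (beta / 2) ^+ 2 <= 1.
  have -> : C * (beta / 2) ^+ 2 = C * beta * (beta / 4) by field.
  have b4 : beta / 4 <= 1 by lra.
  by rewrite mulr_ile1// ?divr_ge0 ?mulr_ge0// ltW.
have M1 : 1 <= M beta := mgf_ge1 mX Hmean Hvar Hexp b0.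
have := @le_ln1Dx R (M beta - 1); rewrite addrCA subrr addr0.
by clear bC C8 Cb; lra.
Qed.

Lemma free_energy_positive : exists c2 beta0, [/\ 0 < c2, 0 < beta0 &
  forall beta, 0 < beta -> beta <= beta0 ->
    0 < free_energy om s b beta (expR (- (c2 / beta)))].
Proof.
have fin (w h m t r l : R) : w <= 1 / 2 -> 0 < h -> m <= 1 -> t + 4 <= r ->
  r - w <= l -> t + m - h < l by lra.
have M_ge1 beta : 0 < beta -> 1 <= M beta by exact: (mgf_ge1 mX Hmean Hvar Hexp).
have [C [C8 Mquad]] : exists C : R, 8 <= C /\ forall beta, 0 < beta ->
    beta <= 1 / 4 -> M (2 * beta) <= 1 + C * beta ^+ 2.
  exists (8 + 128 * M 1); split.
    by rewrite lerDl mulr_ge0// (le_trans ler01)// M_ge1.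
  by move=> beta; exact: (mgf_le_quad mX Hmean Hvar Hexp).
have C0 : 0 < C by exact: lt_le_trans C8.
have s1 : 0 < s.-1%:R :> R by rewrite ltr0n -subn1 subn_gt0.
(* The margin 4 covers the variance loss 1/2 and the term [ln M <= 1], with room to spare. *)
have [K [K1 lnK4]] : exists K : R, 1 < K /\ ln K = ln b / s.-1%:R + 4.
  exists (expR (ln b / s.-1%:R + 4)); rewrite expRK expR_gt1; split => //.
  by rewrite ltr_wpDl// divr_ge0 ?ln_ge0// ltW.
have m0 : 0 < (b - 1) / b by rewrite divr_gt0// subr_gt0.
have [c2 [beta1 [c20 beta10 H]]] := exists_good_level s_ge2 b_gt1 b_sqr (ltW C0) K1 m0.
exists c2, (Num.min beta1 (Num.min (1 / 4) C^-1)); split => //.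
  by rewrite !lt_min beta10 invr_gt0 C0 divr_gt0.
move=> beta b0; rewrite !le_min => /andP[bb1 /andP[b4 bC]].
have b20 : 0 < 2 * beta by rewrite mulr_gt0.
have /andP[q0 q1] := variance_ratio_le (M_ge1 _ b20) (M_ge1 _ b0) (Mquad _ b0 b4).
have {}H r v := H beta _ r v b0 bb1 q0 q1; move: H; rewrite /=.
move: (expR (- (c2 / beta))) (expR_gt0 (- (c2 / beta))) => h h0 H.
have [n [Kn wn]] := H _ _ (rmean0 beta h) (fun m => (rmean_rec h b0 m).2)
  (vmean0 beta h) (vmean_ge0 h b0) (fun m => (vmean_rec h b0 m).2).
clear H; apply: (@free_energy_gt0 _ _ b0 n (ltW h0)).
have K0 : 0 < K by exact: lt_trans K1.
have rn0 : 0 < rmean beta h n by exact: lt_le_trans Kn.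
have lnM : ln (M beta) <= 1.
  apply: (ln_mgf_le1 C8 b0 bC); apply: Mquad; first by rewrite divr_gt0.
  by apply: le_trans b4; rewrite ler_pdivrMr// ler_peMr ?(ltW b0)// ler1n.
have := mean_log_ge_second_moment b_gt1 (mA beta h) (A_gt0 beta h) rn0 (rmean_rec h b0 n).1
  (vmean_rec h b0 n).1.
have : ln K <= ln (rmean beta h n) by rewrite ler_ln ?posrE.
by rewrite lnK4 => lnr lw; exact: fin wn h0 lnM lnr lw.
Qed.

(** Since [n * b ^ n <= expR (n * (1 + ln b))] and [n <= (C0 + 1) / beta ^ 2], both thresholds are
    at least exponentials of order [1 / beta ^ 2]; [c1] adds up the constants. *)
Lemma exists_scale (a eta C0 : R) : 0 < a -> 0 < eta -> 0 < C0 ->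
  exists2 c1, 0 < c1 & forall beta n, 0 < beta -> beta <= 1 -> (0 < n)%N ->
    n%:R <= C0 / beta ^+ 2 + 1 ->
    expR (- (c1 / beta ^+ 2)) <= eta /\
    expR (- (c1 / beta ^+ 2)) <= a / n%:R * (1 / b ^+ n).
Proof.
move=> a0 eta0 C00; have lb : 0 < ln b by rewrite ln_gt0.
pose c1 := `|ln a| + `|ln eta| + (C0 + 1) * (1 + ln b).
have na := normr_ge0 (ln a); have ne := normr_ge0 (ln eta).
have nb : 0 < (C0 + 1) * (1 + ln b) by rewrite mulr_gt0//; lra.
have c10 : 0 < c1 by rewrite /c1; lra.
exists c1 => // beta n b0 b1 n0 nle.
have b20 : 0 < beta ^+ 2 by rewrite exprn_gt0.
have b21 : beta ^+ 2 <= 1 by rewrite exprn_ile1// ltW.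
have b2i : 1 <= (beta ^+ 2)^-1 by rewrite invf_ge1.
have big x : 0 <= x -> x <= x / beta ^+ 2 by move=> x0; rewrite ler_peMr.
split.
  rewrite -[leRHS]lnK ?posrE// ler_expR lerNl.
  apply: (@le_trans _ _ (`|ln eta|)); first by rewrite -normrN ler_norm.
  apply: (@le_trans _ _ c1); last exact: big (ltW c10).
  by rewrite /c1; lra.
have nR : 0 < n%:R :> R by rewrite ltr0n.
have e1 : n%:R <= expR n%:R :> R by have := expR_ge1Dx (n%:R : R); lra.
have e2 : b ^+ n = expR (n%:R * ln b) by rewrite expRM_natl lnK ?posrE.
apply: (@le_trans _ _ (a * expR (- n%:R) * expR (- (n%:R * ln b)))); last first.
  rewrite e2 !expRN div1r ler_pM2r ?invr_gt0 ?expR_gt0//.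
  by rewrite ler_pM2l// lef_pV2 ?posrE ?expR_gt0.
rewrite -[X in _ <= X * _ * _](@lnK _ a) ?posrE// -!expRD ler_expR.
have n1 : n%:R <= (C0 + 1) / beta ^+ 2 by rewrite mulrDl mul1r; lra.
have n2 : n%:R * (1 + ln b) <= (C0 + 1) * (1 + ln b) / beta ^+ 2.
  by rewrite mulrAC ler_wpM2r//; lra.
have := big _ na; have : - ln a <= `|ln a| by rewrite -normrN ler_norm.
have : 0 <= `|ln eta| / beta ^+ 2 by rewrite divr_ge0// ltW.
have -> : c1 / beta ^+ 2 = `|ln a| / beta ^+ 2 + `|ln eta| / beta ^+ 2 +
  (C0 + 1) * (1 + ln b) / beta ^+ 2 by rewrite /c1 !mulrDl.
by lra.
Qed.

(** * The inhomogeneous tilt and its cost *)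

Section tilting.
Variables (alpha beta h : R) (k n : nat).
Hypotheses (alpha_gt0 : 0 < alpha) (alpha_small : 2 * s%:R * alpha <= b - 1).
Hypotheses (beta_gt0 : 0 < beta) (beta_le1 : beta <= 1) (k_gt0 : (0 < k)%N) (n_gt0 : (0 < n)%N).

Let a : R := s%:R * alpha / s.-1%:R.
Let cpsi : R := tilt_gain P X / (1 + M 1).
(** The mean of a site drops by the exponent [2 * (a / n) * b ^ (m - n)]: one half pays for [h], the
    other, times [s - 1], is the source [alpha * s / n * b ^ (m - n)] required by
    [tilted_mean_le]. *)
Let delta m : R := if (m < n)%N
  then 2 * a / (cpsi * beta * n%:R) * (b ^+ m / b ^+ n) else 0.

Hypothesis h_small : h <= a / n%:R * (1 / b ^+ n).
Hypothesis beta_small : 8 * k%:R * a <= cpsi * beta * n%:R.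

Let sR : 0 < s%:R :> R. Proof. by rewrite ltr0n. Qed.
Let s1R : 0 < s.-1%:R :> R. Proof. by rewrite ltr0n -subn1 subn_gt0. Qed.
Let a_gt0 : 0 < a. Proof. by rewrite divr_gt0// mulr_gt0. Qed.
Let cpsi_gt0 : 0 < cpsi.
Proof.
rewrite divr_gt0 ?(tilt_gain_gt0 mX Hmean Hvar)// ltr_pwDl// (le_trans ler01)//.
exact: (mgf_ge1 mX Hmean Hvar Hexp).
Qed.
Let nR : 0 < n%:R :> R. Proof. by rewrite ltr0n. Qed.
Let kR : 1 <= k%:R :> R. Proof. by rewrite ler1n. Qed.
Let cbn_gt0 : 0 < cpsi * beta * n%:R. Proof. exact: mulr_gt0 (mulr_gt0 cpsi_gt0 beta_gt0) nR. Qed.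
Let ratio_ge0 : 0 <= 2 * a / (cpsi * beta * n%:R).
Proof. by apply/ltW/divr_gt0 => //; exact: mulr_gt0. Qed.
Let B_gt0 m : 0 < b ^+ m / b ^+ n. Proof. by rewrite divr_gt0 ?exprn_gt0. Qed.

Lemma delta_ge0 m : 0 <= delta m.
Proof.
by rewrite /delta; case: ifP => // _; exact: mulr_ge0 ratio_ge0 (ltW (B_gt0 m)).
Qed.

Lemma delta_small m : 4 * k%:R * delta m <= 1.
Proof.
rewrite /delta; case: ifPn => [mn|_]; last by rewrite mulr0.
have B1 : b ^+ m / b ^+ n <= 1.
  by rewrite ler_pdivrMr ?exprn_gt0// mul1r ler_eXn2l// ltnW.
have c0 : 0 <= 4 * k%:R * (2 * a / (cpsi * beta * n%:R)).
  by apply: mulr_ge0 ratio_ge0; rewrite mulr_ge0.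
rewrite mulrA (le_trans (ler_wpM2l c0 B1))// mulr1 mulrA ler_pdivrMr// mul1r.
by have := beta_small; lra.
Qed.

Definition tilt_weight (m : nat) (t : R) : R := 1 - delta m * psi t.

Lemma tilt_weight_gt0 m t : 0 < tilt_weight m t.
Proof.
have d0 := delta_ge0 m; have ds := delta_small m; have kk := kR.
have d4 : delta m <= 1 / 4.
  have : 1 * delta m <= k%:R * delta m by rewrite ler_wpM2r.
  by lra.
have /andP[p1 p2] := psi_bound P mX t.
have : delta m * psi t <= delta m * 1 by rewrite ler_wpM2l.
by rewrite /tilt_weight; lra.
Qed.

Lemma measurable_tilt_weight m : measurable_fun setT (tilt_weight m).
Proof.
apply: measurable_funB; first exact: measurable_cst.
apply: measurable_funM; first exact: measurable_cst.
exact: measurable_psi.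
Qed.

Local Notation Rn := (Rn s b (A beta h)).
Local Notation hier_weight := (hier_weight s tilt_weight).

Lemma tilted_mean : exists2 x, E (fun o => Rn n o * hier_weight n o) = x%:E &
  x <= 1 - alpha / 2.
Proof.
have A0 t : 0 <= A beta h t by exact/ltW/A_gt0.
have w0 m t : 0 <= tilt_weight m t by exact/ltW/tilt_weight_gt0.
have Ew m : (E (fun o => tilt_weight m (o 0%N)) = 1%:E)%E.
  by have [] := has_expect_site (measurable_tilt_weight m)
    (has_expect_tilted_weight P mX (delta m)).
have Ey m : exists y, [/\ E (fun o => A beta h (o 0%N) * tilt_weight m (o 0%N)) = y%:E,
    0 <= y & y <= expR (h - delta m * cpsi * beta)].
  have [y hy yle] := has_expect_site_factor_tilted mX Hmean Hvar Hexp h beta_gt0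
    (delta_ge0 m) beta_le1.
  have mAw : measurable_fun setT (fun t => A beta h t * tilt_weight m t).
    by apply: measurable_funM; [exact: mA|exact: measurable_tilt_weight].
  have [_ Ey] := has_expect_site mAw hy.
  exists y; split => //; rewrite -lee_fin -Ey; apply: integral_ge0 => o _.
  by rewrite lee_fin mulr_ge0.
have {}Ey := cid (Ey _).
pose y m := sval (Ey m).
pose rho m := fine (E (fun o => Rn m o * hier_weight m o)).
have Erho m : E (fun o => Rn m o * hier_weight m o) = (rho m)%:E /\
    rho m.+1 = (rho m ^+ s * y m ^+ s.-1 + b - 1) / b.
  have step l : E (fun o => Rn l o * hier_weight l o) = (rho l)%:E ->
      E (fun o => Rn l.+1 o * hier_weight l.+1 o) = ((rho l ^+ s * y l ^+ s.-1 + b - 1) / b)%:E.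
    move=> El; have [Eyl _ _] := svalP (Ey l).
    exact: (expect_Rn_hier_weight s_gt0 b_gt1 (mA beta h) A0 nu_cylinder measurable_tilt_weight w0 Ew El Eyl).
  suff El l : E (fun o => Rn l o * hier_weight l o) = (rho l)%:E by split => //; rewrite {1}/rho step.
  elim: l => [|l IH]; last by rewrite /rho step.
  by rewrite /rho; under eq_integral do rewrite /= mulr1; rewrite (expect_cst nu 1).
exists (rho n); first by have [] := Erho n.
apply: (tilted_mean_le (y := y) b_gt1 b_sqr alpha_gt0 alpha_small) => //.
- move=> m; rewrite -lee_fin -(Erho m).1; apply: integral_ge0 => o _.
  rewrite lee_fin mulr_ge0//; last exact: hier_weight_ge0.
  by apply/ltW/Rn_gt0.
- by move=> m; have [] := svalP (Ey m).
- by rewrite /rho; under eq_integral do rewrite /= mulr1; rewrite (expect_cst nu 1).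
- by move=> m; have [] := Erho m.
move=> m mn; have [_ y0 yle] := svalP (Ey m).
apply: (@le_trans _ _ (expR (h - delta m * cpsi * beta) ^+ s.-1)).
  by rewrite lerXn2r ?nnegrE ?expR_ge0.
rewrite -expRM_natl ler_expR /delta mn.
set B := b ^+ m / b ^+ n.
have -> : 2 * a / (cpsi * beta * n%:R) * B * cpsi * beta = 2 * (a / n%:R * B).
  by field; rewrite !gt_eqF.
have -> : alpha * s%:R / n%:R * B = s.-1%:R * (a / n%:R * B).
  by rewrite /a; field; rewrite !gt_eqF.
have hB : h <= a / n%:R * B.
  apply: (le_trans h_small); apply: ler_wpM2l; first exact/ltW/divr_gt0.
  by rewrite /B ler_pM2r ?invr_gt0 ?exprn_gt0// exprn_ege1// ltW.
by have := ler_wpM2l (ltW s1R) hB; lra.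
Qed.

(** Level [m] has [s.-1 * s ^ (n.-1 - m)] sites, each costing order [delta m ^ 2], proportional to
    [b ^ (2 * (m - n)) = s ^ (m - n)]. Every level thus costs the same, of order
    [1 / (beta * n) ^ 2], and the total is of order [1 / (beta ^ 2 * n)]. *)
Lemma inverse_weight_moment :
  exists2 z, E (fun o => (hier_weight n o)^-1 ^+ k) = z%:E &
  z <= expR ((2 * k%:R + 8 * k%:R ^+ 2) * (2 * a / cpsi) ^+ 2 / (beta ^+ 2 * n%:R)).
Proof.
have Ez m : exists z, has_expect P (fun x => (1 - delta m * psi (X x))^-1 ^+ k) z /\
    0 <= z <= expR ((2 * k%:R + 8 * k%:R ^+ 2) * delta m ^+ 2).
  have [z hz zle] := expect_inv_weight P mX k_gt0 (delta_ge0 m) (delta_small m).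
  by exists z.
have {}Ez := cid (Ez _); pose z m := sval (Ez m).
pose w m t := (tilt_weight m t)^-1 ^+ k.
have mw m : measurable_fun setT (w m).
  rewrite (_ : w m = (fun t => (tilt_weight m t `^ (- 1)) ^+ k)).
    apply: measurable_funX; apply: (measurableT_comp (measurable_powR (-1))).
    exact: measurable_tilt_weight.
  by apply/funext => t; rewrite powR_inv1// ltW// tilt_weight_gt0.
have w0 m t : 0 <= w m t by rewrite exprn_ge0// invr_ge0 ltW// tilt_weight_gt0.
have Ew m : (m < n)%N -> E (fun o => w m (o 0%N)) = (z m)%:E.
  by move=> _; have [hz _] := svalP (Ez m); have [] := has_expect_site (mw m) hz.
have := expect_hier_weight s_gt0 nu_cylinder mw w0 Ew.
set Z := \prod_(_ < _) _ => EZ; exists Z.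
  by rewrite -EZ; apply: eq_integral => o _; rewrite hier_weight_inv hier_weight_exp.
pose Ck : R := 2 * k%:R + 8 * k%:R ^+ 2.
have Ck0 : 0 <= Ck by rewrite /Ck addr_ge0 ?mulr_ge0 ?sqr_ge0 ?ler0n.
pose D := Ck * (2 * a / cpsi) ^+ 2 / (beta * n%:R) ^+ 2.
apply: (@le_trans _ _ (\prod_(m < n) expR D)).
  apply: ler_prod => m _; have [_ /andP[z0 zle]] := svalP (Ez m).
  rewrite exprn_ge0//=; apply: (@le_trans _ _ (expR (Ck * delta m ^+ 2) ^+ (s.-1 * s ^ (n.-1 - m)))).
    by rewrite lerXn2r ?nnegrE ?expR_ge0.
  rewrite -expRM_natl ler_expR /delta ltn_ord.
  have key (j : nat) : (j < n)%N ->
      (s ^ (n.-1 - j))%:R * (b ^+ j / b ^+ n) ^+ 2 = s%:R^-1 :> R.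
    move=> jn; rewrite exprMn exprVn -!exprM ![(_ * 2)%N]mulnC !exprM b_sqr natrX.
    have {2}-> : n = (j + (n.-1 - j).+1)%N.
      by rewrite addnS subnKC ?prednK// -ltnS prednK.
    rewrite exprD exprS; field; rewrite !expf_neq0 ?gt_eqF//.
  have -> : (s.-1 * s ^ (n.-1 - m))%:R *
     (Ck * (2 * a / (cpsi * beta * n%:R) * (b ^+ m / b ^+ n)) ^+ 2) =
     s.-1%:R * s%:R^-1 * D.
    rewrite -(key m (ltn_ord m)) /D natrM; field; rewrite !gt_eqF ?exprn_gt0//.
  rewrite ler_piMl//; first by apply: divr_ge0 (sqr_ge0 _); exact: mulr_ge0 Ck0 (sqr_ge0 _).
  by rewrite ler_pdivrMr// mul1r ler_nat leq_pred.
rewrite prodr_const card_ord -expRM_natl ler_expR.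
rewrite le_eqVlt; apply/orP; left; apply/eqP; rewrite /D /Ck; field.
by rewrite !gt_eqF.
Qed.

End tilting.

Lemma free_energy_eq0 : exists c1 beta0, [/\ 0 < c1, 0 < beta0 &
  forall beta h, 0 < beta -> beta <= beta0 -> h <= expR (- (c1 / beta ^+ 2)) ->
    free_energy om s b beta h = 0].
Proof.
have bg := b_gt1; have bs := b_sqr; have bp := b_gt0.
have sR : 0 < s%:R :> R by rewrite ltr0n.
have s1 : 1 <= s%:R :> R by rewrite ler1n.
have sp : 0 < s.-1%:R :> R by rewrite ltr0n -subn1 subn_gt0.
have sps : s.-1%:R <= s%:R :> R by rewrite ler_nat leq_pred.
have b10 : 0 < b - 1 by lra.
(* Chosen so that, for [v = alpha / 4], the quadratic error [(s * v) ^ 2] equals [(b - 1) / 8 * v],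
   below the linear gain [(b - 1) * b * v]. *)
pose alpha : R := (b - 1) / (2 * s%:R ^+ 2).
have alpha0 : 0 < alpha by rewrite divr_gt0// mulr_gt0// exprn_gt0.
have s2alpha : 2 * s%:R ^+ 2 * alpha = b - 1.
  by rewrite /alpha mulrC divfK// gt_eqF// mulr_gt0// exprn_gt0.
have alpha_small : 2 * s%:R * alpha <= b - 1.
  rewrite -s2alpha ler_pM2r// ler_pM2l// expr2 ler_peMr// ltW//.
pose v : R := alpha / 4.
have v0 : 0 < v by rewrite divr_gt0.
have v1 : v <= 1 / 2.
  have bls : b <= s%:R by rewrite -b_sqr expr2 ler_peMr ?ltW.
  have : b * alpha <= s%:R * alpha by rewrite ler_wpM2r// ltW.
  have : 2 * alpha * b <= 1 * b -> 2 * alpha <= 1 by rewrite ler_pM2r.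
  by rewrite /v; lra.
(* At [p = 1] and [h = 0] the recursion sends [1 - v] strictly below itself; this slack later pays
   for [p < 1] and for a small positive [h]. *)
have gap : (1 - v) ^+ s + (b - 1) < b * (1 - v).
  have : (1 - v) ^+ s <= expR (s%:R * (- v)) by apply: exprn_1D_le; lra.
  rewrite mulrN => e1; have sv : 0 <= s%:R * v by exact: mulr_ge0 (ltW sR) (ltW v0).
  have e2 := expRN_le_quad sv.
  have e3 : (s%:R * v) ^+ 2 = (b - 1) / 8 * v.
    by rewrite -s2alpha /v; field.
  have e4 : s%:R * v = b * (b * v) by rewrite mulrA -expr2 b_sqr.
  have : 0 < (b - 1) * v * (b - 1 / 8).
    by apply: mulr_gt0; [exact: mulr_gt0|lra].
  by have := le_trans e1 e2; rewrite e3 e4; lra.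
have [k k3] := exists_exponent bg gap.
set p : R := k%:R / k.+1%:R => gapp.
have k0 : (0 < k)%N by exact: leq_trans k3.
have k1R : 0 < k.+1%:R :> R by rewrite ltr0n.
have k3R : 3 <= k%:R :> R by rewrite ler_nat.
have pE : p = 1 - k.+1%:R^-1.
  by rewrite /p -[X in X / _](addrK 1 k%:R) natr1 mulrBl divff ?gt_eqF// mul1r.
have kinv : k.+1%:R^-1 <= 1 / 4 :> R.
  by rewrite div1r lef_pV2 ?posrE// -natr1; lra.
have kinv0 : 0 < k.+1%:R^-1 :> R by rewrite invr_gt0.
have [q [qE q0 q4 pq]] : exists q, [/\ k.+1%:R^-1 = q, 0 < q, q <= 1 / 4 & p = 1 - q].
  by exists k.+1%:R^-1.
have p0 : 0 < p by rewrite pq; lra.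
have p1 : p <= 1 by rewrite pq; lra.
set g0 := b `^ p * (1 - v) - ((1 - v) ^+ s + (b - 1) `^ p).
have g00 : 0 < g0 by rewrite /g0 subr_gt0.
(* Makes [expR eta ^+ s.-1 <= 1 + g0], so the site factors use up at most the slack [g0]. *)
pose eta : R := Num.min g0 1 / (2 * s%:R).
have eta0 : 0 < eta by rewrite divr_gt0 ?mulr_gt0// lt_min g00 ltr01.
pose a : R := s%:R * alpha / s.-1%:R.
have a0 : 0 < a by rewrite divr_gt0// mulr_gt0.
pose cpsi : R := tilt_gain P X / (1 + M 1).
have cpsi0 : 0 < cpsi.
  rewrite divr_gt0 ?(tilt_gain_gt0 mX Hmean Hvar)// ltr_pwDl// (le_trans ler01)//.
  exact: (mgf_ge1 mX Hmean Hvar Hexp).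
pose G : R := (2 * k%:R + 8 * k%:R ^+ 2) * (2 * a / cpsi) ^+ 2.
have kR0 : 0 < k%:R :> R by lra.
have G0 : 0 < G.
  apply: mulr_gt0; last by apply/exprn_gt0/divr_gt0 => //; exact: mulr_gt0.
  by apply: addr_gt0; rewrite mulr_gt0 ?exprn_gt0.
have l0 : 0 < ln (1 + alpha / 2) by rewrite ln_gt0//; lra.
(* Once [n >= C0 / beta ^ 2], the inverse weight moment is at most [1 + alpha / 2]. *)
pose C0 := G / ln (1 + alpha / 2).
have C00 : 0 < C0 by rewrite divr_gt0.
have [c1 c10 scale] := exists_scale a0 eta0 C00.
pose beta0 : R := Num.min 1 (cpsi * C0 / (8 * k%:R * a)).
have kan : 0 < 8 * k%:R * a by apply: mulr_gt0 a0; rewrite mulr_gt0.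
exists c1, beta0; split => //.
  by rewrite /beta0 lt_min ltr01 divr_gt0// mulr_gt0.
move=> beta h b0; rewrite le_min => /andP[b1 bC] hle.
have b20 : 0 < beta ^+ 2 by rewrite exprn_gt0.
have [n [n0 nlo nhi]] : exists n : nat, [/\ (0 < n)%N, C0 / beta ^+ 2 <= n%:R &
    n%:R <= C0 / beta ^+ 2 + 1].
  have c0 : 0 <= C0 / beta ^+ 2 by rewrite divr_ge0 ?ltW.
  have /andP[t1 t2] := truncn_itv c0.
  exists (Num.truncn (C0 / beta ^+ 2)).+1; split => //; first exact: ltW.
  by rewrite -natr1 lerD2r.
have nR : 0 < n%:R :> R by rewrite ltr0n.
have [he ha] := scale beta n b0 b1 n0 nhi.
have h_eta := le_trans hle he; have h_a := le_trans hle ha.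
have bs_ : 8 * k%:R * a <= cpsi * beta * n%:R.
  move: bC; rewrite ler_pdivlMr// => bC.
  rewrite ler_pdivrMr// in nlo.
  have : cpsi * C0 <= cpsi * (n%:R * beta ^+ 2) by rewrite ler_pM2l.
  move=> cC; rewrite -(ler_pM2l b0).
  have -> : beta * (cpsi * beta * n%:R) = cpsi * (n%:R * beta ^+ 2) by ring.
  exact: le_trans bC cC.
have [x Ex xle] := tilted_mean alpha0 alpha_small b0 b1 k0 n0 h_a bs_.
have [z Ez zle] := inverse_weight_moment alpha0 b0 k0 n0 bs_.
have {}zle : z <= 1 + alpha / 2.
  apply: (le_trans zle); rewrite -[leRHS]lnK ?posrE; last lra.
  rewrite ler_expR -/G ler_pdivrMr ?mulr_gt0// mulrC -ler_pdivrMr//.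
  have := nlo; rewrite -(ler_pM2r b20) divfK ?gt_eqF// => le.
  by rewrite [leRHS]mulrC.
set w := tilt_weight alpha beta n in Ex Ez.
set Ab := A beta h in Ex.
have A0 t : 0 < Ab t by exact: A_gt0.
have wp m t : 0 < w m t by exact: (tilt_weight_gt0 alpha0 b0 k0 n0 bs_).
have mw m : measurable_fun setT (w m) by exact: measurable_tilt_weight.
have mR m : measurable_fun setT (Rn s b Ab m) by apply: measurable_Rn; exact: mA.
have mRp m : measurable_fun setT (fun o => Rn s b Ab m o `^ p).
  exact: measurableT_comp (measurable_powR p) (mR m).
have R0 m o : 0 < Rn s b Ab m o by apply: Rn_gt0 => // t; exact: ltW.
have start : (E (fun o => Rn s b Ab n o `^ p) <= (1 - v)%:E)%E.
  have mRG : measurable_fun setT (fun o => Rn s b Ab n o * hier_weight s w n o).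
    by apply: measurable_funM => //; exact: measurable_hier_weight.
  have mGi : measurable_fun setT (fun o => (hier_weight s w n o)^-1 ^+ k).
    rewrite (_ : (fun o => _) = (fun o => (hier_weight s w n o `^ (- 1)) ^+ k)); last first.
      by apply/funext => o; rewrite powR_inv1// ltW// hier_weight_gt0.
    apply: measurable_funX; apply: (measurableT_comp (measurable_powR (-1))).
    exact: measurable_hier_weight.
  have RG0 o : 0 <= Rn s b Ab n o * hier_weight s w n o by rewrite mulr_ge0// ltW// hier_weight_gt0.
  have Gi0 o : 0 <= (hier_weight s w n o)^-1 ^+ k by rewrite exprn_ge0// invr_ge0 ltW// hier_weight_gt0.
  (* The bounds on [x] and [z] give at most [1 - alpha / 2 + q * alpha], and [q <= 1/4] brings this
     to [1 - alpha / 4 = 1 - v]. *)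
  apply: (@le_trans _ _ (p * x + q * z)%:E); last first.
    rewrite lee_fin /v.
    have : p * x <= p * (1 - alpha / 2) by exact: ler_wpM2l (ltW p0) _ _ xle.
    have : q * z <= q * (1 + alpha / 2) by exact: ler_wpM2l (ltW q0) _ _ zle.
    have : q * alpha <= 1 / 4 * alpha by exact: ler_wpM2r (ltW alpha0) _ _ q4.
    by rewrite pq; lra.
  rewrite -(expect_comb mRG mGi RG0 Gi0 (ltW p0) (ltW q0) Ex Ez).
  apply: expect_le => //.
  - apply: measurable_funD; apply: measurable_funM => //; exact: measurable_cst.
  - by move=> o; exact: powR_ge0.
  - by move=> o; rewrite -qE; apply: powR_young; [exact: ltW|exact: hier_weight_gt0].
pose y : R := expR eta.
(* Young's inequality with [g = 1] reduces the fractional moment of a site to its mean [expR h]. *)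
have EA : (E (fun o => Ab (o 0%N) `^ p) <= y%:E)%E.
  have [_ EAb] := site_mean h b0.
  have mAb : measurable_fun setT (fun o : seqT R => Ab (o 0%N)).
    exact: measurableT_comp (mA beta h) (measurable_coord _).
  apply: (@le_trans _ _ (p * expR h + q)%:E).
    rewrite -(expect_affine mAb (fun o => ltW (A0 _)) (ltW p0) (ltW q0) EAb).
    apply: expect_le => //.
    - exact: measurableT_comp (measurable_powR p) mAb.
    - by apply: measurable_funD => //; apply: measurable_funM.
    - by move=> o; exact: powR_ge0.
    move=> o; have := powR_young k (ltW (A0 (o 0%N))) ltr01.
    by rewrite -/p qE mulr1 invr1 expr1n mulr1.
  rewrite lee_fin /y.
  have : p * expR h <= p * expR eta.
    by apply: ler_wpM2l (ltW p0) _ _ _; rewrite ler_expR.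
  have : q * 1 <= q * expR eta.
    rewrite ler_wpM2l ?(ltW q0)//; apply: le_trans (expR_ge1Dx _).
    by rewrite lerDl ltW.
  by rewrite pq; lra.
have stable : ((1 - v) ^+ s * y ^+ s.-1 + (b - 1) `^ p) / b `^ p <= 1 - v.
  rewrite ler_pdivrMr ?powR_gt0// [leRHS]mulrC.
  have se : s.-1%:R * eta <= Num.min g0 1 / 2.
    have -> : Num.min g0 1 / 2 = s%:R * eta by rewrite /eta; field; rewrite gt_eqF.
    exact: ler_wpM2r (ltW eta0) _ _ sps.
  have m1 : Num.min g0 1 <= 1 by rewrite ge_min lexx orbT.
  have mg : Num.min g0 1 <= g0 by rewrite ge_min lexx.
  have se0 : 0 <= s.-1%:R * eta by exact: mulr_ge0 (ltW sp) (ltW eta0).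
  have ys : y ^+ s.-1 <= 1 + g0.
    rewrite /y -expRM_natl.
    have se2 : s.-1%:R * eta <= 1 / 2 by lra.
    apply: (le_trans (expR_le_quad se2)).
    have : (s.-1%:R * eta) ^+ 2 <= s.-1%:R * eta * (1 / 2) by rewrite expr2 ler_wpM2l.
    by lra.
  have vs0 : 0 <= (1 - v) ^+ s by rewrite exprn_ge0//; lra.
  have vs1 : (1 - v) ^+ s <= 1 by rewrite exprn_ile1//; lra.
  have : (1 - v) ^+ s * y ^+ s.-1 <= (1 - v) ^+ s * (1 + g0) by rewrite ler_wpM2l.
  have : (1 - v) ^+ s * g0 <= 1 * g0 by rewrite ler_wpM2r// ltW.
  by rewrite /g0; lra.
have frac m : (n <= m)%N -> (E (fun o => Rn s b Ab m o `^ p) <= (1 - v)%:E)%E.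
  move=> /subnK <-; elim: (m - n)%N => [|l IH]; first by rewrite add0n.
  rewrite addSn; apply: (le_trans (expect_Rn_powR s_ge2 bg (mA beta h) A0 nu_cylinder p0 p1 IH EA)).
  by rewrite lee_fin.
rewrite free_energyE.
apply: (@lim_div_expn_eq0 _ _ s_ge2 _ (- ln ((b - 1) / b)) n).
  move=> m; rewrite opprK.
  exact: (mean_log_ge bg (mA beta h) A0 (rmean_rec h b0 m).1).
move=> m nm; apply: (mean_log_le0 bg (mA beta h) A0 p0 (rmean_rec h b0 m).1).
by rewrite (le_trans (frac m nm))// lee_fin lerBlDr lerDl ltW.
Qed.

Lemma hcrit_bounds : exists c1 c2 beta0 : R, [/\ 0 < c1, 0 < c2, 0 < beta0 &
    forall beta : R, 0 < beta -> beta <= beta0 ->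
      expR (- (c1 / beta ^+ 2)) <= hcrit om s b beta /\
      hcrit om s b beta <= expR (- (c2 / beta))].
Proof.
have [c1 [beta1 [c10 b10 low]]] := free_energy_eq0.
have [c2 [beta2 [c20 b20 up]]] := free_energy_positive.
exists c1, c2, (Num.min beta1 beta2); split => //; first by rewrite lt_min b10.
move=> beta b0; rewrite le_min => /andP[bb1 bb2].
(* [free_energy_eq0] covers every real [h] up to the threshold. Together with the member found next,
   this makes the set nonempty and bounded below, so [inf] is a true infimum. *)
have lb : lbound [set h | 0 < free_energy om s b beta h] (expR (- (c1 / beta ^+ 2))).
  move=> h /= fh; rewrite leNgt; apply/negP => /ltW hle.
  by move: fh; rewrite (low _ _ b0 bb1 hle) ltxx.
have mem : [set h | 0 < free_energy om s b beta h] (expR (- (c2 / beta))).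
  exact: up.
split; first by apply: lb_le_inf => //; exists (expR (- (c2 / beta))).
by apply: ge_inf => //; exists (expR (- (c1 / beta ^+ 2))).
Qed.

End pinning_model.

Unset Implicit Arguments.

Theorem theorem1p5 (s : nat) (hs : (2 <= s)%N)
  (d : measure_display) (T : measurableType d) (R : realType)
  (P : probability T R) (om : nat -> {RV P >-> R})
  (Hind : mutually_independent om) (Hid : identically_distributed om)
  (Hmean : (\int[P]_x (om 0%N x)%:E = 0)%E)
  (Hvar : (\int[P]_x ((om 0%N x) ^+ 2)%:E = 1)%E)
  (Hexp : forall beta : R, 0 < beta ->
     P.-integrable setT (fun x => (expR (beta * om 0%N x))%:E)) :
  exists c1 c2 beta0 : R, [/\ 0 < c1, 0 < c2, 0 < beta0 &
    forall beta : R, 0 < beta -> beta <= beta0 ->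
      expR (- (c1 / beta ^+ 2)) <= hcrit om s (Num.sqrt (s%:R)) beta /\
      hcrit om s (Num.sqrt (s%:R)) beta <= expR (- (c2 / beta))].
Proof. exact: hcrit_bounds. Qed.
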